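(* Let $\mathbb{K}$ be a field, $S$ a polynomial ring over $\mathbb{K}$ in finitely many variables, and let $I \subset S$ be a monomial ideal with $k$ minimal generators. If $\operatorname{pdim} S/I \in \{1,2,k-2,k-1,k\}$, then the Stanley conjecture holds for $S/I$ and for $I$, i.e. $\operatorname{spdim}S/I\le\operatorname{pdim}S/I$ and $\operatorname{spdim}I\le\operatorname{pdim}I$.
   Context: $S=\mathbb{K}[X_1,\dots,X_n]$ carries the fine $\mathbb{Z}^n$-grading, monomial ideals are nonzero and proper, and $\operatorname{pdim}$ is projective dimension over $S$. For a finitely generated $\mathbb{Z}^n$-graded $S$-module $M$, a Stanley space of $M$ is a $\mathbb{K}[Z]$-submodule $\lambda\mathbb{K}[Z]\subseteq M$ ($\lambda\in M$ homogeneous, $Z\subseteq\{X_1,\dots,X_n\}$) that is free over $\mathbb{K}[Z]$. A Stanley decomposition of $M$ is a finite family of Stanley spaces with $M\cong\bigoplus_i\lambda_i\mathbb{K}[Z_i]$ as multigraded $\mathbb{K}$-vector spaces; its depth is $\min_i|Z_i|$. $\operatorname{sdepth}M$ is the maximal depth of a Stanley decomposition of $M$, and $\operatorname{spdim}M=n-\operatorname{sdepth}M$. The Stanley conjecture for $M$ is the inequality $\operatorname{depth}M\le\operatorname{sdepth}M$, equivalently $\operatorname{spdim}M\le\operatorname{pdim}M$. *)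

(* Defs.v *)
From HB Require Import structures.
From mathcomp Require Import all_boot all_order all_algebra.
From mathcomp.multinomials Require Export mpoly.
From mathcomp.classical Require boolp.

Set Implicit Arguments.
Unset Strict Implicit.
Unset Printing Implicit Defensive.

Import GRing.Theory.
Local Open Scope ring_scope.
Local Open Scope quotient_scope.

(* The library gives R/I a ring structure only; it is made an R-module here. *)
Definition quot_proj (R : comNzRingType) (I : idealr R) (a : R) :
  {ideal_quot I} := \pi a.

Section QuotientModule.
Variables (R : comNzRingType) (I : idealr R).

Definition quot_scale (a : R) (u : {ideal_quot I}) : {ideal_quot I} :=
  quot_proj I a * u.

Lemma quot_scaleA a b u :
  quot_scale a (quot_scale b u) = quot_scale (a * b) u.
Proof. by rewrite /quot_scale /quot_proj rmorphM mulrA. Qed.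

Lemma quot_scale1 : left_id 1 quot_scale.
Proof. by move=> u; rewrite /quot_scale /quot_proj rmorph1 mul1r. Qed.

Lemma quot_scaleDr : right_distributive quot_scale +%R.
Proof. by move=> a u v; rewrite /quot_scale mulrDr. Qed.

Lemma quot_scaleDl u : {morph quot_scale^~ u : a b / a + b}.
Proof. by move=> a b; rewrite /quot_scale /quot_proj raddfD mulrDl. Qed.

HB.instance Definition _ := GRing.Zmodule_isLmodule.Build R {ideal_quot I}
  quot_scaleA quot_scale1 quot_scaleDr quot_scaleDl.

End QuotientModule.

(* I as an R-submodule of R. *)
Record ideal_mod (R : comNzRingType) (I : idealr R) : Type :=
  IdealMod { ideal_val : R^o; ideal_valP : ideal_val \in (I : pred R) }.

Section IdealModule.
Variables (R : comNzRingType) (I : idealr R).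

HB.instance Definition _ := [isSub for @ideal_val R I].
HB.instance Definition _ := [Choice of ideal_mod I by <:].

Lemma ideal_submod_closed : submod_closed ((I : pred R) : pred R^o).
Proof.
split=> [|a u v uI vI]; first exact: idealr0.
by apply: (@rpredD R I) => //; apply: idealMr.
Qed.

HB.instance Definition _ :=
  GRing.SubChoice_isSubLmodule.Build R R^o _ (ideal_mod I) ideal_submod_closed.

End IdealModule.

Definition projective (R : nzRingType) (P : lmodType R) : Prop :=
  forall (M N : lmodType R) (g : {linear M -> N}) (f : {linear P -> N}),
    (forall y, exists x, g x = y) ->
    exists h : {linear P -> M}, forall x, g (h x) = f x.

(* M has a projective resolution 0 -> P_d -> ... -> P_0 -> M -> 0. *)
Definition has_proj_resolution (R : nzRingType) (M : lmodType R) (d : nat) :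
    Prop :=
  exists (P : nat -> lmodType R) (e : {linear P 0%N -> M})
         (f : forall i, {linear P i.+1 -> P i}),
    [/\ forall i, projective (P i),
        forall i, (d < i)%N -> forall x : P i, x = 0,
        forall y, exists x, e x = y,
        forall x, e x = 0 <-> exists y, f 0%N y = x
      & forall i x, f i x = 0 <-> exists y, f i.+1 y = x].

Definition is_pdim (R : nzRingType) (M : lmodType R) (d : nat) : Prop :=
  has_proj_resolution M d /\
  forall e, has_proj_resolution M e -> (d <= e)%N.

Definition in_monomial_span (n : nat) (K : fieldType)
    (A : 'X_{1..n} -> Prop) (p : {mpoly K[n]}) : Prop :=
  exists s : seq ({mpoly K[n]} * 'X_{1..n}),
    (forall x, x \in s -> A x.2) /\ p = \sum_(x <- s) x.1 * 'X_[x.2].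

Definition generates (n : nat) (K : fieldType) (A : 'X_{1..n} -> Prop)
    (I : idealr {mpoly K[n]}) : Prop :=
  forall p, p \in (I : pred _) <-> in_monomial_span A p.

(* An [idealr] is proper by definition and given by a boolean predicate; under
   the classical axioms every proper ideal is of this form. *)
Definition monomial_ideal (n : nat) (K : fieldType)
    (I : idealr {mpoly K[n]}) : Prop :=
  (exists A, generates A I) /\ exists2 p, p \in (I : pred _) & p != 0.

Definition minimal_generators (n : nat) (K : fieldType)
    (I : idealr {mpoly K[n]}) (G : seq 'X_{1..n}) : Prop :=
  [/\ uniq G, generates (fun m => m \in G) I
    & forall H : seq 'X_{1..n},
        {subset H <= G} -> generates (fun m => m \in H) I -> {subset G <= H}].

(* A Z^n-grading of M is given by its homogeneous components:
   [gr a u] means that u lies in M_a. *)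
Definition grading (n : nat) (K : fieldType) (M : lmodType {mpoly K[n]}) :
  Type := ('I_n -> int) -> M -> Prop.

Definition poly_gr (n : nat) (K : fieldType) (a : 'I_n -> int)
    (p : {mpoly K[n]}) : Prop :=
  forall m, m \in msupp p -> forall i, (m i)%:Z = a i.

Definition quot_gr (n : nat) (K : fieldType) (I : idealr {mpoly K[n]}) :
    grading {ideal_quot I} :=
  fun a u => exists2 p, poly_gr a p & u = quot_proj I p.

Definition ideal_gr (n : nat) (K : fieldType) (I : idealr {mpoly K[n]}) :
    grading (ideal_mod I) :=
  fun a u => poly_gr a (ideal_val u).

(* The subalgebra K[Z] of S. *)
Definition poly_in (n : nat) (K : fieldType) (Z : {set 'I_n})
    (p : {mpoly K[n]}) : Prop :=
  forall m, m \in msupp p -> forall i, i \notin Z -> m i = 0%N.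

Definition stanley_sub (n : nat) (K : fieldType) (M : lmodType {mpoly K[n]})
    (lam : M) (Z : {set 'I_n}) (u : M) : Prop :=
  exists2 f : {mpoly K[n]}, poly_in Z f & u = f *: lam.

(* lam is homogeneous and a K[Z]-basis of lam K[Z]. *)
Definition is_stanley_space (n : nat) (K : fieldType)
    (M : lmodType {mpoly K[n]}) (gr : grading M) (lam : M) (Z : {set 'I_n}) :
    Prop :=
  (exists a, gr a lam) /\
  forall f : {mpoly K[n]}, poly_in Z f -> f *: lam = 0 -> f = 0.

(* The external direct sum of the lam_i K[Z_i] is the set of u : M^r with
   u_i in lam_i K[Z_i]; phi is a degree-preserving K-linear bijection from it
   onto M. *)
Definition is_stanley_decomposition (n : nat) (K : fieldType)
    (M : lmodType {mpoly K[n]}) (gr : grading M) (r : nat)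
    (lam : 'I_r -> M) (Z : 'I_r -> {set 'I_n}) : Prop :=
  let D (u : {ffun 'I_r -> M}) := forall i, stanley_sub (lam i) (Z i) (u i) in
  (forall i, is_stanley_space gr (lam i) (Z i)) /\
  exists phi : {ffun 'I_r -> M} -> M,
    [/\ forall (c : K) u v, D u -> D v ->
          phi (c%:MP *: u + v) = c%:MP *: phi u + phi v,
        forall a u, D u -> (forall i, gr a (u i)) -> gr a (phi u)
      & forall x, exists! u, D u /\ phi u = x].

(* Every #|Z_i| is at most n, so n is neutral for the minimum. *)
Definition stanley_depth (n r : nat) (Z : 'I_r -> {set 'I_n}) : nat :=
  \big[minn/n]_(i < r) #|Z i|.

Definition sdepth (n : nat) (K : fieldType) (M : lmodType {mpoly K[n]})
    (gr : grading M) : nat :=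
  \max_(d < n.+1 |
    boolp.asbool (exists (r : nat) (lam : 'I_r -> M) (Z : 'I_r -> {set 'I_n}),
      is_stanley_decomposition gr lam Z /\ stanley_depth Z = d)) d.

Definition spdim (n : nat) (K : fieldType) (M : lmodType {mpoly K[n]})
    (gr : grading M) : nat := (n - sdepth gr)%N.

(* Main.v *)
(* The monomials outside I, and those inside I, are partitioned into cones
   a + N^Z with Z large.  Two devices suffice.  If J is spanned by g_1, ..., g_r,
   then J is the disjoint union of the translates by g_i of the monomials outside
   (g_1, ..., g_(i-1)) : g_i.  And for a variable x, the monomials outside I are
   those outside the ideal I' obtained by setting x = 1, with x free, together
   with, for each exponent a of x, those of I' outside the ideal spanned by the
   generators of x-degree at most a.  The second device sacrifices x, but deals
   with a quotient of ideals, for which the first one gains one variable back,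
   since the colon ideals have fewer generators.

   The projective dimension enters through the Taylor complex T: a resolution of
   length p of S/I gives a contracting homotopy of T in degrees above p, and
   reading its constant terms gives combinatorial conditions on lcms.
   - If p <= k - 1, some generator divides the lcm of the others.
   - If p <= k - 2, the generators v with lcm(G \ v) = lcm G form a connected
     graph, with an edge vw when lcm(G \ {v, w}) = lcm G, and for every other v
     some such w divides the lcm of G \ {v, w}.  A vertex whose removal leaves the
     graph connected is a good choice for the last generator.
   - If p <= 2, take a graph on G, minimal such that for every monomial m the
     generators dividing m induce a connected subgraph.  Relations between the
     syzygies given by its edges have no constant term; as the syzygy module is
     projective they vanish, so the graph is a tree.  Removing leaves then gives
     principal colon ideals.
   - If p <= 1, some generator divides all the others.
   Finally pdim S/I <= pdim I + 1. *)
From HB Require Import structures.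
Require Import Defs.
From mathcomp Require Import all_boot all_order all_algebra.
From mathcomp Require Import zify.
From mathcomp.classical Require boolp.

Set Implicit Arguments.
Unset Strict Implicit.
Unset Printing Implicit Defensive.

Import GRing.Theory.
Local Open Scope ring_scope.

(** * Partitions of sets of monomials into cones *)

Section Cones.
Local Open Scope nat_scope.
Variable n : nat.
Implicit Types (c : 'X_{1..n} * {set 'I_n}) (E : pred 'X_{1..n}) (m : 'X_{1..n}).

(** The pair [(a, Z)] encodes the cone a + N^Z: coordinates outside Z are frozen at their value in
    a. *)
Definition in_cone c m :=
  (c.1 <= m)%MM && [forall x, (x \notin c.2) ==> (m x == c.1 x)].

(* The cones listed by [s] partition [E]. *)
Definition stanley_codim_le (p : nat) E : Prop :=
  exists2 s, all (fun c => n - p <= #|c.2|) s &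
    forall m, count (in_cone^~ m) s = E m.

Lemma in_coneP c m :
  reflect (forall x, c.1 x <= m x /\ (x \notin c.2 -> m x = c.1 x)) (in_cone c m).
Proof.
apply: (iffP andP) => [[/mnm_lepP le /forallP eq] x|H].
  by split=> // xc; apply/eqP; have /implyP := eq x; apply.
split; first by apply/mnm_lepP => x; case: (H x).
by apply/forallP => x; apply/implyP => xc; apply/eqP; case: (H x) => _; apply.
Qed.

Lemma stanley_codim_le_ext p E E' :
  E =1 E' -> stanley_codim_le p E -> stanley_codim_le p E'.
Proof. by move=> eqE [s sp sE]; exists s => // m; rewrite sE eqE. Qed.

Lemma stanley_codim_leW p q E :
  p <= q -> stanley_codim_le p E -> stanley_codim_le q E.
Proof.
move=> pq [s sp sE]; exists s => //; apply: sub_all sp => c.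
by apply: leq_trans; rewrite leq_sub2l.
Qed.

Lemma stanley_codim_le_pred0 p E : (forall m, ~~ E m) -> stanley_codim_le p E.
Proof. by move=> E0; exists [::] => // m; rewrite (negbTE (E0 m)). Qed.

Lemma stanley_codim_le_predT E : (forall m, E m) -> stanley_codim_le 0 E.
Proof.
move=> ET; exists [:: (0%MM, [set: 'I_n])] => [|m].
  by rewrite /= cardsT card_ord subn0 leqnn.
rewrite /= addn0 ET; suff -> : in_cone (0%MM, [set: 'I_n]) m by [].
by apply/in_coneP => x; rewrite /= mnm0E inE; split.
Qed.

(** The sum of truth values, read in [nat], expresses at once that [E] is the union and that the
    union is disjoint. *)
Lemma stanley_codim_leU p E1 E2 E : (forall m, E1 m + E2 m = E m) ->
  stanley_codim_le p E1 -> stanley_codim_le p E2 -> stanley_codim_le p E.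
Proof.
move=> EU [s1 s1p s1E] [s2 s2p s2E]; exists (s1 ++ s2) => [|m].
  by rewrite all_cat s1p.
by rewrite count_cat s1E s2E EU.
Qed.

Lemma stanley_codim_le_shift p E (a : 'X_{1..n}) : stanley_codim_le p E ->
  stanley_codim_le p [pred m | (a <= m)%MM && E (m - a)%MM].
Proof.
move=> [s sp sE]; exists [seq ((c.1 + a)%MM, c.2) | c <- s] => [|m].
  by rewrite all_map.
rewrite count_map /=; case: (boolP (a <= m)%MM) => [/mnm_lepP le_am|Nle] /=.
  rewrite -sE; apply: eq_count => c /=; apply/in_coneP/in_coneP => H x;
    case: (H x) => /=; rewrite ?mnmDE ?mnmBE => Hx1 Hx2;
    have := le_am x; split; try (by lia); move=> xc; have := Hx2 xc; lia.
rewrite (@eq_count _ _ pred0) ?count_pred0 // => c /=; apply/negP => /in_coneP H.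
move/mnm_lepP: Nle; apply=> x; case: (H x) => /=; rewrite mnmDE; lia.
Qed.

Definition set_exponent (x : 'I_n) (a : nat) m : 'X_{1..n} :=
  [multinom (if y == x then a else m y) | y < n].

Lemma stanley_codim_le_slice p E (x : 'I_n) (a : nat) : stanley_codim_le p E ->
  stanley_codim_le p.+1 [pred m : 'X_{1..n} | (m x == a) && E m].
Proof.
move=> [s sp sE].
(* [keep] selects the cones that meet the slice. The trace of such a cone is a cone with [x] frozen
   at [a], which costs at most one free variable. *)
pose keep c := if x \in c.2 then c.1 x <= a else c.1 x == a.
exists [seq (set_exponent x a c.1, c.2 :\ x) | c <- s & keep c] => [|m].
  rewrite all_map all_filter; apply: sub_all sp => c /= ncp.
  apply/implyP => _; move: ncp; rewrite (cardsD1 x c.2).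
  by move: #|_ :\ x| (x \in c.2) => k [] /=; lia.
rewrite count_map count_filter /=.
case: eqP => [mxa|Nmxa] /=.
  rewrite -sE; apply: eq_count => c /=; rewrite /keep.
  apply/andP/in_coneP => [[/in_coneP H kc] y|H].
    have [Hle Heq] := H y; move: Hle Heq => /=; rewrite !mnmE !inE.
    case: (eqVneq y x) => [->{y}|yx] /=; last by [].
    move=> _ Heq; rewrite mxa; case: ifP kc => // xc; last by move/eqP->.
  split; last first.
    have [Hle Heq] := H x; rewrite mxa in Hle Heq.
    by case: ifP => // /negbT xc; rewrite (Heq xc).
  apply/in_coneP => y; have [Hle Heq] := H y; rewrite /= !mnmE !inE.
  by case: (eqVneq y x) => [->{y Hle Heq}|yx] //=; rewrite mxa.
rewrite (@eq_count _ _ pred0) ?count_pred0 // => c /=; apply/negP.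
case/andP => /in_coneP H _; case: (H x) => /=; rewrite mnmE !inE eqxx /=.
by move=> _ /(_ isT).
Qed.

End Cones.

(** * Monomial ideals, their colons, and setting a variable to 1 *)

Section MonomialIdeals.
Local Open Scope nat_scope.
Variables (n : nat) (T : finType).
Implicit Types (g : T -> 'X_{1..n}) (A B C : {set T}) (m : 'X_{1..n}).
Implicit Types (W : {set 'I_n}) (x : 'I_n).

Definition in_ideal g A m := [exists v in A, (g v <= m)%MM].

Definition ideal_compl g A : pred 'X_{1..n} := fun m => ~~ in_ideal g A m.

Definition ideal_diff g B C : pred 'X_{1..n} :=
  fun m => in_ideal g B m && ~~ in_ideal g C m.

(** Subtraction of exponents is truncated, so this is g_i / gcd(g_i, g_v): the generators of the
    colon ideal by g_v. *)
Definition colon v g : T -> 'X_{1..n} := fun i => (g i - g v)%MM.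

Definition kill x g : T -> 'X_{1..n} := fun i => set_exponent x 0 (g i).

(** [W] bounds the variables that occur; its size is the induction measure, since [colon] keeps [W]
    and [kill] shrinks it. *)
Definition supported W g := forall v x, x \notin W -> g v x = 0.

Lemma in_idealP g A m :
  reflect (exists2 v, v \in A & (g v <= m)%MM) (in_ideal g A m).
Proof. exact: exists_inP. Qed.

Lemma in_idealS g A B m : A \subset B -> in_ideal g A m -> in_ideal g B m.
Proof.
by move/subsetP => AB /in_idealP [v vA vm]; apply/in_idealP; exists v => //; apply: AB.
Qed.

Lemma in_ideal0 g m : in_ideal g set0 m = false.
Proof. by apply/in_idealP => -[v]; rewrite inE. Qed.

Lemma in_idealU1 g A v m : in_ideal g (v |: A) m = (g v <= m)%MM || in_ideal g A m.
Proof.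
apply/in_idealP/orP => [[u]|[vm|/in_idealP [u uA um]]].
- by rewrite !inE => /predU1P[->|uA] um; [left | right; apply/in_idealP; exists u].
- by exists v; rewrite ?setU11.
- by exists u; rewrite ?setU1r.
Qed.

Lemma colon_ideal g A v m :
  in_ideal (colon v g) A m = in_ideal g A (g v + m)%MM.
Proof.
apply: eq_existsb => u; congr (_ && _); apply/mnm_lepP/mnm_lepP => H x;
  by have := H x; rewrite mnmDE mnmBE leq_subLR.
Qed.

Lemma kill_le x g v m : (g v <= m)%MM = (kill x g v <= m)%MM && (g v x <= m x).
Proof.
apply/mnm_lepP/andP => [le|[/mnm_lepP le lex] y].
  by split=> //; apply/mnm_lepP => y; rewrite mnmE; case: eqP.
by have := le y; rewrite mnmE; case: eqP => [->|].
Qed.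

Lemma supported_colon W g v : supported W g -> supported W (colon v g).
Proof. by move=> sg u x xW; rewrite mnmBE !sg. Qed.

Lemma supported_kill W g x : supported W g -> supported (W :\ x) (kill x g).
Proof.
move=> sg u y; rewrite !inE mnmE negb_and negbK.
by case: eqP => //= _ yW; apply: sg.
Qed.

Lemma supported_set0 g v : supported set0 g -> g v = 0%MM.
Proof. by move=> sg; apply/mnmP => x; rewrite mnm0E sg ?inE. Qed.

Lemma ideal_compl_gen0 g A v p :
  v \in A -> g v = 0%MM -> stanley_codim_le p (ideal_compl g A).
Proof.
move=> vA gv0; apply: stanley_codim_le_pred0 => m; rewrite /ideal_compl negbK.
by apply/in_idealP; exists v => //; rewrite gv0; apply/mnm_lepP => x; rewrite mnm0E.
Qed.

Lemma ideal_diffxx g B p : stanley_codim_le p (ideal_diff g B B).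
Proof. by apply: stanley_codim_le_pred0 => m; rewrite /ideal_diff andbN. Qed.

(** What [v] contributes beyond [B] is the translate by [g v] of the complement of a colon ideal; as
    [C] lies in [B], these monomials also avoid [C]. *)
Lemma ideal_diffU1 p g B C v : C \subset B ->
  stanley_codim_le p (ideal_diff g B C) ->
  stanley_codim_le p (ideal_compl (colon v g) B) ->
  stanley_codim_le p (ideal_diff g (v |: B) C).
Proof.
move=> CB sB /(@stanley_codim_le_shift _ _ _ (g v)); apply: stanley_codim_leU sB.
move=> m; rewrite /ideal_diff /= in_idealU1 /ideal_compl colon_ideal addmC.
case: (boolP (g v <= m)%MM) => [le_vm|_] /=; last by rewrite addn0.
rewrite submK //; case: (boolP (in_ideal g B m)) => [//|NB]; first by rewrite addn0.
by rewrite (contra (@in_idealS _ _ _ _ CB) NB).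
Qed.

(** The generators of [B] outside [C] are added one at a time. Those already present miss the new
    one, so only colons of proper subsets of [B] occur. *)
Lemma ideal_diff_chain p g B C : C \subset B ->
  (forall C' v, C' \proper B -> v \in B :\: C' ->
    stanley_codim_le p (ideal_compl (colon v g) C')) ->
  stanley_codim_le p (ideal_diff g B C).
Proof.
have [k] := ubnP #|B :\: C|; elim: k => // k IHk in B * => ltk CB H.
have [BC0|/set0Pn[v vBC]] := eqVneq (B :\: C) set0.
  have -> : B = C by apply/eqP; rewrite eqEsubset CB -setD_eq0 BC0 eqxx.
  exact: ideal_diffxx.
have [vC vB] : v \notin C /\ v \in B by move: vBC; rewrite inE => /andP [].
have CBv : C \subset B :\ v by rewrite subsetD1 CB vC.
have Bv : B :\ v \proper B by apply: properD1.
rewrite -(setD1K vB); apply: ideal_diffU1 => //; last first.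
  by apply: H; rewrite ?inE ?eqxx ?vB.
apply: IHk => // [|C' w C'B wB]; last first.
  apply: H; first exact: (proper_trans C'B).
  by move: wB; rewrite !inE => /and3P [-> _ ->].
move: ltk; rewrite (cardsD1 v) vBC setDDl setUC -setDDl; lia.
Qed.

(** Outside the ideal of [kill x g] the variable [x] stays free. Inside it, the exponent [a] of [x]
    decides which generators can divide; each [a] is treated separately, and freezing [x] costs one,
    whence [p.-1]. *)
Lemma ideal_compl_slice p g A x : 0 < p ->
  stanley_codim_le p (ideal_compl (kill x g) A) ->
  (forall a, stanley_codim_le p.-1
     (ideal_diff (kill x g) A [set v in A | g v x <= a])) ->
  stanley_codim_le p (ideal_compl g A).
Proof.
move=> p0 sA sa; pose D a := ideal_diff (kill x g) A [set v in A | g v x <= a].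
pose M := \max_(v in A) g v x.
have gM v : v \in A -> g v x <= M by move=> vA; rewrite /M (bigD1 v) //= leq_maxl.
have idE m : in_ideal g A m =
    in_ideal (kill x g) [set v in A | g v x <= m x] m.
  apply/in_idealP/in_idealP => [[v vA]|[v]].
    by rewrite (kill_le x) => /andP[vm vx]; exists v; rewrite ?inE ?vA.
  by rewrite inE => /andP[vA vx] vm; exists v => //; rewrite (kill_le x) vm.
suff step b : stanley_codim_le p
    [pred m : 'X_{1..n} | ideal_compl (kill x g) A m || (m x < b) && D (m x) m].
  apply: stanley_codim_le_ext (step M) => m /=.
  rewrite /ideal_compl /D /ideal_diff idE.
  set S := [set v in A | g v x <= m x].
  have SA : S \subset A by apply/subsetP => v; rewrite inE => /andP[].
  case: (boolP (in_ideal (kill x g) A m)) => [inA|NinA] /=; last first.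
    by rewrite (contra (@in_idealS _ _ _ _ SA) NinA).
  case: ltnP => //= Mm; suff -> : S = A by rewrite inA.
  by apply/setP => v; rewrite inE; case: (boolP (v \in A)) => //= /gM; lia.
elim: b => [|b IHb].
  by apply: stanley_codim_le_ext sA => m /=; rewrite orbF.
have := stanley_codim_le_slice x b (sa b); rewrite prednK // => sb.
apply: stanley_codim_leU IHb sb => m /=; rewrite /ideal_compl /D /ideal_diff.
case: (boolP (in_ideal (kill x g) A m)) => _ //=; last by rewrite andbF.
have -> : (m x < b.+1) = (m x == b) || (m x < b) by rewrite ltnS leq_eqVlt.
by case: (eqVneq (m x) b) => [->|_] /=; rewrite ?ltnn ?addn0.
Qed.

End MonomialIdeals.

(** * Generators dividing the lcm of others *)

Section FewGenerators.
Local Open Scope nat_scope.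
Variables (n : nat) (T : finType).
Implicit Types (g : T -> 'X_{1..n}) (A B C V : {set T}) (W : {set 'I_n}).

(** Induction on the number of variables that occur. Slicing freezes [x], but the colon ideals
    inside a slice have fewer than [#|A|] generators, which makes up for the loss. *)
Lemma ideal_compl_card g A : stanley_codim_le #|A| (ideal_compl g A).
Proof.
have [W] : exists W, supported W g by exists setT => v x; rewrite inE.
have [k] := ubnP #|W|; elim: k => // k IHk in W g A * => ltk sg.
have [->|/set0Pn [v vA]] := eqVneq A set0.
  rewrite cards0; apply: stanley_codim_le_predT => m.
  by rewrite /ideal_compl in_ideal0.
have [W0|/set0Pn [x xW]] := eqVneq W set0.
  by apply: (ideal_compl_gen0 _ vA); apply: supported_set0; rewrite -W0.
have A0 : 0 < #|A| by rewrite card_gt0; apply/set0Pn; exists v.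
have sk := supported_kill (x := x) sg.
have ltx : #|W :\ x| < k by move: ltk; rewrite (cardsD1 x) xW.
apply: (ideal_compl_slice (x := x)) => // [|a]; first exact: IHk sk.
apply: ideal_diff_chain => [|C w CA _].
  by apply/subsetP => u; rewrite inE => /andP [].
apply: stanley_codim_leW (IHk _ _ _ ltx (supported_colon w sk)).
by have := proper_card CA; lia.
Qed.

Lemma ideal_diff_card g B C :
  C \subset B -> stanley_codim_le #|B|.-1 (ideal_diff g B C).
Proof.
move=> CB; apply: ideal_diff_chain => // C' w C'B _.
by apply: stanley_codim_leW (ideal_compl_card _ _); have := proper_card C'B; lia.
Qed.

(** Divisibility of the lcm of the [g j], [j] in [B], written coordinatewise; the empty lcm is 1. *)
Definition covered g B i := [forall x, g i x <= \max_(j in B) g j x].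

Lemma coveredP g B i :
  reflect (forall x, g i x <= \max_(j in B) g j x) (covered g B i).
Proof. exact: forallP. Qed.

Lemma covered0 g i : covered g set0 i -> g i = 0%MM.
Proof.
move/coveredP => H; apply/mnmP => x; have := H x.
by rewrite big_set0 leqn0 mnm0E => /eqP.
Qed.

Lemma covered_kill g B i x : covered g B i -> covered (kill x g) B i.
Proof.
move/coveredP => H; apply/coveredP => y; rewrite mnmE; case: eqP => // /eqP yx.
apply: leq_trans (H y) _; apply/bigmax_leqP => j jB.
by rewrite (bigmax_sup j) // mnmE (negbTE yx).
Qed.

Lemma covered_colon g B i v : covered g (v |: B) i -> covered (colon v g) B i.
Proof.
move/coveredP => H; apply/coveredP => x; rewrite mnmBE leq_subLR.
apply: leq_trans (H x) _; apply/bigmax_leqP => j; rewrite !inE.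
case/predU1P => [->|jB]; first exact: leq_addr.
by rewrite -leq_subLR (bigmax_sup j) // mnmBE.
Qed.

Definition one_covered g A := exists2 i, i \in A & covered g (A :\ i) i.

Lemma one_covered_colon g A v i : v != i -> v \in A -> i \in A ->
  covered g (A :\ i) i -> one_covered (colon v g) (A :\ v).
Proof.
move=> vi vA iA ci; exists i; first by rewrite !inE eq_sym vi.
apply: covered_colon; rewrite (_ : v |: _ = A :\ i) //.
by apply/setP => j; rewrite !inE; case: (eqVneq j v) => [->|] //=; rewrite vi vA.
Qed.

(** Only the generator added last meets a colon ideal with [#|B|.-1] generators; all earlier ones
    meet smaller ones, to which the general bound applies. So the extra saving is required at [v]
    alone. *)
Lemma ideal_diff_card1 g B C v : C \subset B -> v \in B :\: C ->
  stanley_codim_le #|B|.-2 (ideal_compl (colon v g) (B :\ v)) ->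
  stanley_codim_le #|B|.-2 (ideal_diff g B C).
Proof.
move=> CB; rewrite inE => /andP [vC vB] H; rewrite -{2}(setD1K vB).
have CBv : C \subset B :\ v by rewrite subsetD1 CB.
apply: ideal_diffU1 => //; apply: stanley_codim_leW (ideal_diff_card _ CBv).
by rewrite (cardsD1 v B) vB.
Qed.

(** The slicing induction again, with the last generator of each slice chosen different from the
    covered one [i]: then [i] remains covered in the last colon ideal. *)
Lemma ideal_compl_covered g A :
  one_covered g A -> stanley_codim_le #|A|.-1 (ideal_compl g A).
Proof.
have [W] : exists W, supported W g by exists setT => v x; rewrite inE.
have [k] := ubnP #|W|; elim: k => // k IHk in W g A * => ltk sg [i iA ci].
have [Ai0|/set0Pn [w wAi]] := eqVneq (A :\ i) set0.
  by apply: (ideal_compl_gen0 _ iA); apply: covered0; rewrite -Ai0.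
have [W0|/set0Pn [x xW]] := eqVneq W set0.
  by apply: (ideal_compl_gen0 _ iA); apply: supported_set0; rewrite -W0.
have cA : #|A| = (#|A :\ i :\ w|.+2)%N.
  by rewrite (cardsD1 i) iA (cardsD1 w (A :\ i)) wAi.
have sk := supported_kill (x := x) sg.
have ltx : #|W :\ x| < k by move: ltk; rewrite (cardsD1 x) xW.
apply: (ideal_compl_slice (x := x)) => [||a]; first by rewrite cA.
  by apply: (IHk _ _ _ ltx sk); exists i => //; apply: covered_kill.
set C := [set v in A | _]; have CA : C \subset A.
  by apply/subsetP => u; rewrite inE => /andP [].
have [AC|] := eqVneq (A :\: C) set0.
  have -> : C = A by apply/eqP; rewrite eqEsubset CA -setD_eq0 AC eqxx.
  exact: ideal_diffxx.
(* If [i] has [x]-exponent above [a], then so has one of the generators whose lcm it divides. *)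
move=> NAC; have [v vAC vi] : exists2 v, v \in A :\: C & v != i.
  case/set0Pn: NAC => u uAC; have [ui|] := eqVneq u i; last by exists u.
  move: uAC; rewrite ui !inE iA andbT /= -ltnNge => ai.
  have /coveredP /(_ x) := ci; rewrite leqNgt => /negP Nle.
  have [j jA aj] : exists2 j, j \in A :\ i & a < g j x.
    have := leq_trans ai (coveredP _ _ _ ci x).
    case: (eqVneq (\max_(j in A :\ i) g j x) 0) => [->//|N0 lt].
    have A0 : 0 < #|A :\ i| by rewrite card_gt0; apply/set0Pn; exists w.
    by have [j jA mj] := eq_bigmax_cond (fun j => g j x) A0; exists j; rewrite // -mj.
  move: jA; rewrite !inE => /andP [ji jA]; exists j => //.
  by rewrite !inE jA andbT /= -ltnNge.
have vA : v \in A by move: vAC; rewrite inE => /andP [].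
apply: (ideal_diff_card1 CA vAC).
have -> : #|A|.-2 = #|A :\ v|.-1 by rewrite (cardsD1 v A) vA.
apply: (IHk _ _ _ ltx (supported_colon v sk)).
by apply: (@one_covered_colon _ _ _ i) => //; apply: covered_kill.
Qed.

Lemma in_ideal_covered g A :
  one_covered g A -> stanley_codim_le #|A|.-2 (in_ideal g A).
Proof.
move=> [i iA ci]; have [Ai0|/set0Pn [w wAi]] := eqVneq (A :\ i) set0.
  apply: (@stanley_codim_leW _ 0) => //; apply: stanley_codim_le_predT => m.
  apply/in_idealP; exists i => //; rewrite (@covered0 g i) -?Ai0 //.
  by apply/mnm_lepP => x; rewrite mnm0E.
have [wi wA] : w != i /\ w \in A by move: wAi; rewrite !inE => /andP [].
apply: (@stanley_codim_le_ext _ _ (ideal_diff g A set0)) => [m|].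
  by rewrite /ideal_diff in_ideal0 andbT.
apply: (@ideal_diff_card1 _ _ _ w); rewrite ?sub0set ?setD0 //.
have -> : #|A|.-2 = #|A :\ w|.-1 by rewrite (cardsD1 w A) wA.
by apply: ideal_compl_covered; apply: (@one_covered_colon _ _ _ i).
Qed.

End FewGenerators.

(** * Connected subgraphs *)

Section CutConnected.
Variable T : finType.
Implicit Types (e : rel T) (B C P Y : {set T}).

(** Connectedness of the subgraph induced on [Y], expressed by cuts so that no paths have to be
    handled; the empty set counts as connected. *)
Definition cut_connected e Y := [forall P : {set T},
  [&& P \subset Y, P != set0 & P != Y] ==> [exists i in P, exists j in Y :\: P, e i j]].

Lemma cut_connectedP e Y :
  reflect (forall P : {set T}, P \subset Y -> P != set0 -> P != Y ->
             exists i j, [/\ i \in P, j \in Y, j \notin P & e i j])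
    (cut_connected e Y).
Proof.
apply: (iffP forallP) => [H P PY P0 PnY|H P].
  have /implyP := H P; rewrite PY P0 PnY => /(_ isT).
  case/exists_inP => i iP /exists_inP [j]; rewrite inE => /andP [jP jY] eij.
  by exists i, j.
apply/implyP => /and3P [PY P0 PnY]; have [i [j [iP jY jP eij]]] := H P PY P0 PnY.
by apply/exists_inP; exists i => //; apply/exists_inP; exists j; rewrite // inE jP.
Qed.

Lemma cut_connected0 e : cut_connected e set0.
Proof. by apply/cut_connectedP => P; rewrite subset0 => /eqP ->; rewrite eqxx. Qed.

Lemma sub_cut_connected e e' Y : {in Y &, forall i j, e i j -> e' i j} ->
  cut_connected e Y -> cut_connected e' Y.
Proof.
move=> ee' /cut_connectedP H; apply/cut_connectedP => P PY P0 PnY.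
have [i [j [iP jY jP eij]]] := H P PY P0 PnY; exists i, j; split=> //.
by apply: ee' => //; apply: (subsetP PY).
Qed.

Lemma cut_connectedU1 e C j : symmetric e -> cut_connected e C -> j \notin C ->
  C = set0 \/ (exists2 i, i \in C & e i j) -> cut_connected e (j |: C).
Proof.
move=> esym /cut_connectedP H jC hC; apply/cut_connectedP => P PjC P0 PnjC.
have PC : P :\ j \subset C by rewrite subDset.
case: (boolP (j \in P)) => jP; last first.
  have PjE : P :\ j = P.
    by apply/setP => u; rewrite !inE; case: eqP => // ->; rewrite (negbTE jP).
  have [PeC|PnC] := eqVneq P C; last first.
    have [|a [b [aP bC bP eab]]] := H P _ P0 PnC; first by rewrite -PjE.
    by exists a, b; rewrite setU1r.
  case: hC => [C0|[i iC eij]]; first by rewrite PeC C0 eqxx in P0.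
  by exists i, j; rewrite PeC setU11.
have [P0'|P0'] := eqVneq (P :\ j) set0.
  have PE : P = [set j] by rewrite -(setD1K jP) P0' setU0.
  case: hC => [C0|[i iC eij]]; first by rewrite PE C0 setU0 eqxx in PnjC.
  exists j, i; split; rewrite ?setU1r // ?PE ?inE; last by rewrite esym.
  by apply: contraNneq jC => <-.
have [PeC|PnC] := eqVneq (P :\ j) C; first by rewrite -PeC setD1K ?eqxx in PnjC.
have [a [b [aP bC bP eab]]] := H _ PC P0' PnC.
exists a, b; split; rewrite ?setU1r //; first by move: aP; rewrite inE => /andP [].
by apply: contra bP => bP; rewrite !inE bP andbT; apply: contraNneq jC => <-.
Qed.

(** Here [v] is a leaf. A cut of the rest becomes a cut of [Y] when [v] joins the side of its
    neighbour, and then the crossing edge does not involve [v]. *)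
Lemma cut_connectedD1 e Y v : symmetric e -> cut_connected e Y -> v \in Y ->
  {in Y :\ v &, forall u w, e v u -> e v w -> u = w} -> cut_connected e (Y :\ v).
Proof.
move=> esym /cut_connectedP H vY leaf; apply/cut_connectedP => P PY P0 PnY.
have vP : v \notin P by apply/negP => /(subsetP PY); rewrite !inE eqxx.
have PYv : P \subset Y := subset_trans PY (subsetDl _ _).
case: (boolP [exists h in P, e v h]) => [/exists_inP [h hP evh]|/exists_inP noh].
  have [| | |a [b [aP bY]]] := H (v |: P).
  - by rewrite subUset sub1set vY PYv.
  - by apply/set0Pn; exists v; rewrite setU11.
  - by apply: contraNneq PnY => <-; rewrite setU1K.
  rewrite !inE negb_or => /andP [bv bP] eab.
  have bYv : b \in Y :\ v by rewrite !inE bv.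
  case/setU1P: aP => [av|aP]; last by exists a, b.
  rewrite av in eab; have bh := leaf b h bYv (subsetP PY _ hP) eab evh.
  by rewrite bh hP in bP.
have [| | |a [b [aP bY bP eab]]] := H P => //.
  by apply: contraNneq vP => ->.
exists a, b; split=> //; rewrite !inE bY andbT; apply/eqP => bv.
by apply: noh; exists a => //; rewrite esym -bv.
Qed.

(** Take a maximal connected [D] between [C] and [B], other than [B]. Adding a vertex [j] adjacent
    to [D] keeps it connected, so maximality forces [j |: D] to be [B], and [j] is the vertex
    sought. *)
Lemma cut_connected_noncut e B C : symmetric e ->
  cut_connected e B -> cut_connected e C -> C \proper B ->
  exists2 v, v \in B :\: C & cut_connected e (B :\ v).
Proof.
move=> esym /cut_connectedP connB connC CB.
pose Q (D : {set T}) := [&& C \subset D, D \proper B & cut_connected e D].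
have [|D maxD CD] := @maxset_exists _ Q C; first by rewrite /Q subxx CB.
have /and3P [_ DB connD] := maxsetp maxD.
have DsB := proper_sub DB.
have [j [jB jD connjD]] : exists j, [/\ j \in B, j \notin D & cut_connected e (j |: D)].
  have [D0|D0] := eqVneq D set0.
    have /properP [_ [j jB jD]] := DB; exists j; split=> //.
    by apply: cut_connectedU1 => //; left.
  have [|i [j [iD jB jD eij]]] := connB D DsB D0.
    by apply: contraTneq DB => ->; rewrite properxx.
  by exists j; split=> //; apply: cut_connectedU1 => //; right; exists i.
have jDB : j |: D \subset B by rewrite subUset sub1set jB.
exists j; first by rewrite inE jB andbT; apply: contra jD; apply: (subsetP CD).
suff <- : D = B :\ j by [].
have [<-|jDnB] := eqVneq (j |: D) B; first by rewrite setU1K.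
have QjD : Q (j |: D).
  by rewrite /Q connjD (subset_trans CD (subsetUr _ _)) properEneq jDnB jDB.
by have := maxsetsup maxD QjD (subsetUr _ _) => DE; rewrite -DE setU11 in jD.
Qed.

Lemma cut_connected_star e Y c : symmetric e -> c \in Y ->
  {in Y :\ c, forall i, e c i} -> cut_connected e Y.
Proof.
move=> esym cY star; apply/cut_connectedP => P PY P0 PnY.
have [cP|cP] := boolP (c \in P).
  have /properP [_ [j jY jP]] : P \proper Y by rewrite properEneq PnY.
  exists c, j; split=> //; apply: star; rewrite !inE jY andbT.
  by apply: contraNneq jP => ->.
case/set0Pn: P0 => i iP; exists i, c; split=> //; rewrite esym; apply: star.
by rewrite !inE (subsetP PY _ iP) andbT; apply: contraNneq cP => <-.
Qed.

End CutConnected.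

(** * Projective dimension two less than the number of generators *)

Section TwoCovered.
Local Open Scope nat_scope.
Variables (n : nat) (T : finType).
Implicit Types (g : T -> 'X_{1..n}) (A B C V : {set T}) (W : {set 'I_n}).

Definition edge g A : rel T :=
  fun i j => covered g (A :\ i :\ j) i && covered g (A :\ i :\ j) j.

(** [V] may be smaller than the set of all covered generators; this lets the same [V] serve after
    passing to a colon ideal, where more generators may become covered. *)
Definition two_covered g A := exists V, [/\ V \subset A, V != set0,
  {in V, forall v, covered g (A :\ v) v}, cut_connected (edge g A) V &
  forall v, v \in A :\: V -> exists2 i, i \in V & covered g (A :\ v :\ i) i].

Lemma setD1C A i j : A :\ i :\ j = A :\ j :\ i.
Proof. by rewrite !setDDl setUC. Qed.

Lemma edge_sym g A : symmetric (edge g A).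
Proof. by move=> i j; rewrite /edge setD1C andbC. Qed.

Lemma colon_kill g v x : colon v (kill x g) = kill x (colon v g).
Proof.
apply: boolp.funext => i; apply/mnmP => y; rewrite !mnmE.
by case: eqP; rewrite ?subn0.
Qed.

Lemma two_covered_kill g A x : two_covered g A -> two_covered (kill x g) A.
Proof.
move=> [V [VA V0 cV conV cAV]]; exists V; split=> //.
- by move=> v vV; apply: covered_kill; apply: cV.
- apply: sub_cut_connected conV => i j _ _ /andP [ei ej].
  by rewrite /edge !covered_kill.
- by move=> v /cAV [i iV ci]; exists i => //; apply: covered_kill.
Qed.

Lemma two_covered_colon g A V v : v \in A -> V \subset A :\ v -> V != set0 ->
  {in V, forall u, covered g (A :\ u) u} -> cut_connected (edge g A) V ->
  (forall u, u \in A :\: V -> u != v ->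
     exists2 i, i \in V & covered g (A :\ u :\ i) i) ->
  two_covered (colon v g) (A :\ v).
Proof.
move=> vA VA V0 cV conV cAV.
have Vv i : i \in V -> i != v.
  by move=> iV; have := subsetP VA i iV; rewrite !inE => /andP [].
have U1E u : u != v -> v |: A :\ v :\ u = A :\ u.
  move=> uv; apply/setP => w; rewrite !inE; case: (eqVneq w v) => [->|] //=.
  by rewrite vA eq_sym uv.
have U2E u w : u != v -> w != v -> v |: A :\ v :\ u :\ w = A :\ u :\ w.
  move=> uv wv; apply/setP => z; rewrite !inE; case: (eqVneq z v) => [->|] //=.
  by rewrite vA ![v == _]eq_sym uv wv.
exists V; split=> //.
- by move=> u uV; apply: covered_colon; rewrite U1E ?Vv //; apply: cV.
- apply: sub_cut_connected conV => i j iV jV /andP [ei ej].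
  by rewrite /edge !covered_colon // U2E ?Vv.
- move=> u; rewrite !inE => /and3P [uV uv uA].
  have [|i iV ci] := cAV u _ uv; first by rewrite inE uV.
  by exists i => //; apply: covered_colon; rewrite U2E // Vv.
Qed.

(** With at most two generators, the conditions make some generator divide an empty lcm. *)
Lemma two_covered_small g A :
  two_covered g A -> #|A| <= 2 -> exists2 i, i \in A & g i = 0%MM.
Proof.
move=> [V [VA /set0Pn [i iV] cV conV cAV]] A2; have iA := subsetP VA i iV.
have [Ai0|/set0Pn [j jAi]] := eqVneq (A :\ i) set0.
  by exists i => //; apply: covered0; rewrite -Ai0; apply: cV.
have Aij : A :\ i :\ j = set0.
  apply/eqP; rewrite -cards_eq0; move: A2.
  by rewrite (cardsD1 i A) iA (cardsD1 j (A :\ i)) jAi; case: #|_|.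
have [ji jA] : j != i /\ j \in A by move: jAi; rewrite !inE => /andP [].
exists i => //; apply: covered0.
have [jV|jV] := boolP (j \in V).
  have [| | |a [b [aV bV ab /andP [ea eb]]]] := (cut_connectedP _ _ conV) [set i].
  - by rewrite sub1set.
  - by apply/set0Pn; exists i; rewrite inE.
  - by apply: contraTneq jV => <-; rewrite inE.
  move: aV ab; rewrite !inE => /eqP ai bi; rewrite ai in ea.
  suff bj : b = j by rewrite bj Aij in ea.
  apply/eqP; move: (in_set0 b); rewrite -Aij !inE bi (subsetP VA b bV) !andbT.
  by move/negbFE.
have [|l lV] := cAV j; first by rewrite inE jV.
have -> : l = i.
  apply/eqP; move: (in_set0 l); rewrite -Aij !inE (subsetP VA l lV) andbT.
  have -> : l != j by apply: contraTneq lV => ->.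
  by move/negbFE.
by rewrite setD1C Aij.
Qed.

Lemma bigmax_geP (B : {set T}) (f : T -> nat) a : 0 < a ->
  a <= \max_(j in B) f j -> exists2 j, j \in B & a <= f j.
Proof.
move=> a0 aB; have [B0|B0] := posnP #|B|.
  by move: aB; rewrite (cards0_eq B0) big_set0; case: a a0.
by have [j jB mj] := eq_bigmax_cond f B0; exists j; rewrite // -mj.
Qed.

(* [v] can be added last: what remains after dividing by [g v] is again
   two-covered, and some generator [i] then allows a good second to last
   choice. *)
Definition removable g A v := [/\ v \in A, two_covered (colon v g) (A :\ v) &
  exists2 i, i \in A :\ v & covered g (A :\ v :\ i) i].

Lemma removable_noncut g A v : {in A, forall u, covered g (A :\ u) u} ->
  cut_connected (edge g A) A -> v \in A -> A :\ v != set0 ->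
  cut_connected (edge g A) (A :\ v) -> removable g A v.
Proof.
move=> cA conA vA Av0 conAv; split=> //.
  apply: (two_covered_colon vA _ Av0 _ conAv) => //.
    by move=> u; rewrite !inE => /andP [_ uA]; apply: cA.
  move=> u; rewrite !inE negb_and negbK => /andP [/orP [->//|uA] uA' _].
  by rewrite uA' in uA.
have [| | |a [b [aV bA ab /andP [ea eb]]]] := (cut_connectedP _ _ conA) [set v].
- by rewrite sub1set.
- by apply/set0Pn; exists v; rewrite inE.
- by apply: contraNneq Av0 => <-; rewrite setDv.
move: aV ab; rewrite !inE => /eqP av bv; rewrite av in ea eb.
by exists b => //; rewrite !inE bv.
Qed.

(** The first conclusion serves the ideal itself. For its complement, [v] must also have the largest
    exponent in the sliced variable, so that it lies outside [[set u in A | g u x <= a]] as soon as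
    some generator does. *)
Lemma two_covered_select g A : two_covered g A -> 1 < #|A| ->
  (exists v, removable g A v) /\
  ({in A, forall u, g u = 0%MM} \/
   exists v x, [/\ removable g A v, {in A, forall u, g u x <= g v x} & 0 < g v x]).
Proof.
move=> [V [VA V0 cV conV cAV]] A1.
have [/exists_inP [v vAV Ncv]|/exists_inP Nv] :=
    boolP [exists v in A :\: V, ~~ covered g (A :\ v) v].
  have [vA vV] : v \in A /\ v \notin V by move: vAV; rewrite inE => /andP [].
  (* An uncovered [v] lies outside [V], and in some variable its exponent strictly exceeds all
     others. *)
  have rv : removable g A v.
    split=> //; first by apply: (@two_covered_colon _ _ V); rewrite // ?subsetD1 ?VA //;
      move=> u uAV _; apply: cAV.
    have [i iV ci] := cAV v vAV; exists i => //; rewrite !inE (subsetP VA) // andbT.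
    by apply: contraTneq iV => ->.
  split; first by exists v.
  right; case/forallPn: Ncv => x; rewrite -ltnNge => ltx; exists v, x; split=> //.
    move=> u uA; have [->//|uv] := eqVneq u v; apply: ltnW; apply: leq_ltn_trans ltx.
    by rewrite (bigmax_sup u) // !inE uv.
  by apply: leq_ltn_trans ltx.
have cA : {in A, forall u, covered g (A :\ u) u}.
  move=> u uA; have [|uV] := boolP (u \in V); first exact: cV.
  by apply: contraPT (Nv) => ncu; case; exists u; rewrite // inE uV.
(* Once all generators are covered, every vertex outside [V] has an edge into [V], so all of [A] is
   connected. *)
have conA : cut_connected (edge g A) A.
  apply/cut_connectedP => P PA P0 PnA; have Psym := @edge_sym g A.
  have attach u : u \in A -> u \notin V -> exists2 i, i \in V & edge g A u i.
    move=> uA uV; have [|i iV ci] := cAV u; first by rewrite inE uV.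
    exists i => //; rewrite /edge ci andbT; apply/coveredP => x.
    have [->//|gx] := posnP (g u x).
    have [j jAu jx] := bigmax_geP gx (coveredP _ _ _ (cA u uA) x).
    have [ji|ji] := eqVneq j i.
      by rewrite ji in jx; apply: leq_trans jx (coveredP _ _ _ ci x).
    by rewrite (bigmax_sup j) // !inE ji; move: jAu; rewrite !inE.
  have [VP|] := boolP (V \subset P).
    have /properP [_ [u uA uP]] : P \proper A by rewrite properEneq PnA.
    have [|i iV eui] := attach u uA; first by apply: contra uP; apply: (subsetP VP).
    by exists i, u; split=> //; [exact: (subsetP VP) | rewrite Psym].
  move=> NVP; have [PV0|PV0] := eqVneq (P :&: V) set0.
    case/set0Pn: P0 => u uP; have uA := subsetP PA u uP.
    have PVn w : w \in V -> w \notin P.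
      by move=> wV; apply/negP => wP; have := in_set0 w; rewrite -PV0 inE wP wV.
    have [|i iV eui] := attach u uA; first by apply/negP => /PVn; rewrite uP.
    by exists u, i; split=> //; [exact: (subsetP VA) | exact: PVn].
  have [|a [b [aP bV bP eab]]] := (cut_connectedP _ _ conV) _ (subsetIr P V) PV0.
    by apply: contraNneq NVP => <-; rewrite subsetIl.
  exists a, b; split=> //; first by move: aP; rewrite inE => /andP [].
    exact: (subsetP VA).
  by apply: contra bP => bP; rewrite inE bP.
have A0 : set0 \proper A by rewrite proper0 -card_gt0 ltnW.
have Av0 u : A :\ u != set0.
  by rewrite -card_gt0; move: A1; rewrite (cardsD1 u A); case: (u \in A) => //= /ltnW.
have [v vA conAv] := cut_connected_noncut (@edge_sym g A) conA (cut_connected0 _) A0.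
rewrite setD0 in vA; have rv : removable g A v by apply: removable_noncut.
split; first by exists v.
have [/existsP [x /andP [/forall_inP lex gx]]|/existsP Ntop] :=
    boolP [exists x, [forall u in A, g u x <= g v x] && (0 < g v x)].
  by right; exists v, x.
have [/forall_inP g0|/forall_inPn [u uA gu]] := boolP [forall u in A, g u == 0%MM].
  by left => u uA; apply/eqP; apply: g0.
right; have [x gux] : exists x, 0 < g u x.
  apply/existsP; apply: contraNT gu => /existsPn H; apply/eqP/mnmP => x.
  by rewrite mnm0E; have := H x; rewrite -eqn0Ngt => /eqP.
have above y : 0 < g v y -> exists2 w, w \in A & g v y < g w y.
  move=> gvy; have [/exists_inP //|/exists_inP Nw] :=
    boolP [exists w in A, g v y < g w y].
  case: Ntop; exists y; rewrite gvy andbT.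
  by apply/forall_inP => w wA; rewrite leqNgt; apply/negP => ?; apply: Nw; exists w.
case: (arg_maxnP (fun w => g w x) uA) => w wA wx.
have gwx : 0 < g w x by apply: leq_trans gux (wx u uA).
have wv : w != v.
  apply/eqP => wv; case: Ntop; exists x; rewrite -wv gwx andbT.
  exact/forall_inP.
exists w, x; split=> //; apply: removable_noncut => //.
apply: (@cut_connected_star _ _ _ v) => [||i]; first exact: edge_sym.
  by rewrite !inE eq_sym wv.
rewrite !inE => /and3P [iv iw iA].
have cov y : g v y <= \max_(j in A :\ v :\ i) g j y /\
             g i y <= \max_(j in A :\ v :\ i) g j y.
  have ci : g i y <= \max_(j in A :\ v :\ i) g j y.
    have [->//|giy] := posnP (g i y).
    have [j jA ij] := bigmax_geP giy (coveredP _ _ _ (cA i iA) y).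
    have [jv|jv] := eqVneq j v; last first.
      by rewrite (bigmax_sup j) //; move: jA; rewrite !inE jv.
    rewrite jv in ij; have [z zA vz] := above y (leq_trans giy ij).
    have iz := leq_ltn_trans ij vz.
    rewrite (bigmax_sup z) ?(ltnW iz) // !inE zA andbT.
    by apply/andP; split; apply/eqP => zE; rewrite zE ltnn in iz vz.
  split=> //; have [->//|gvy] := posnP (g v y).
  have [z zA vz] := above y gvy; have [zi|zi] := eqVneq z i.
    by apply: leq_trans ci; rewrite -zi ltnW.
  rewrite (bigmax_sup z) ?(ltnW vz) // !inE zA zi andbT.
  by apply/eqP => zE; rewrite zE ltnn in vz.
by apply/andP; split; apply/coveredP => y; case: (cov y).
Qed.

End TwoCovered.

(** * Cone partitions for two-covered generators *)

Section TwoCoveredBounds.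
Local Open Scope nat_scope.
Variables (n : nat) (T : finType).
Implicit Types (g : T -> 'X_{1..n}) (A C : {set T}) (W : {set 'I_n}).

(** Only the last two additions need care: [v] comes last, and before it some [w] other than [i], so
    that [i] stays covered. Earlier colon ideals have at most [#|A| - 3] generators. *)
Lemma ideal_diff_card2 g A C v i : C \subset A -> v \in A -> v \notin C ->
  i \in A :\ v -> covered g (A :\ v :\ i) i ->
  (A :\ v != C -> exists2 w, w \in A :\ v :\: C & w != i) ->
  stanley_codim_le #|A|.-2.-1 (ideal_compl (colon v g) (A :\ v)) ->
  stanley_codim_le #|A|.-2.-1 (ideal_diff g A C).
Proof.
move=> CA vA vC iAv ci Hw sv; rewrite -{2}(setD1K vA).
have CAv : C \subset A :\ v by rewrite subsetD1 CA.
apply: ideal_diffU1 => //; have [->|/Hw [w wAvC wi]] := eqVneq (A :\ v) C.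
  exact: ideal_diffxx.
have wAv : w \in A :\ v by move: wAvC; rewrite inE => /andP [].
have -> : #|A|.-2.-1 = #|A :\ v|.-2 by rewrite (cardsD1 v A) vA.
apply: (ideal_diff_card1 CAv wAvC).
have -> : #|A :\ v|.-2 = #|A :\ v :\ w|.-1 by rewrite (cardsD1 w (A :\ v)) wAv.
by apply: ideal_compl_covered; apply: (@one_covered_colon _ _ _ _ _ i).
Qed.

Lemma ideal_compl_two_covered g A :
  two_covered g A -> stanley_codim_le #|A|.-2 (ideal_compl g A).
Proof.
have [W] : exists W, supported W g by exists setT => v x; rewrite inE.
have [k] := ubnP #|W|; elim: k => // k IHk in W g A * => ltk sg tA.
have [A2|A2] := leqP #|A| 2.
  by have [i iA gi0] := two_covered_small tA A2; apply: (ideal_compl_gen0 _ iA).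
have [_ [g0|[v [x [[vA tv [i iAv ci]] vx gvx]]]]] := two_covered_select tA (ltnW A2).
  have /set0Pn [u uA] : A != set0 by rewrite -card_gt0; lia.
  by apply: (ideal_compl_gen0 _ uA); apply: g0.
have xW : x \in W by apply: contraTT gvx => xW; rewrite sg.
have sk := supported_kill (x := x) sg.
have ltx : #|W :\ x| < k by move: ltk; rewrite (cardsD1 x) xW.
apply: (ideal_compl_slice (x := x)) => [||a]; first by lia.
  by apply: (IHk _ _ _ ltx sk); apply: two_covered_kill.
set C := [set u in A | _]; have CA : C \subset A.
  by apply/subsetP => u; rewrite inE => /andP [].
(* By maximality of the exponent of [v], either all generators are in [C] or [v] is not. *)
have [va|av] := leqP (g v x) a.
  suff -> : C = A by apply: ideal_diffxx.
  apply/setP => u; rewrite inE; case: (boolP (u \in A)) => //= /vx.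
  by move/leq_trans; apply.
apply: (ideal_diff_card2 CA vA (i := i)) => //.
- by rewrite !inE vA -ltnNge.
- exact: covered_kill.
- move=> AvC; have /set0Pn [w wAvC] : A :\ v :\: C != set0.
    apply: contraNneq AvC => /eqP; rewrite setD_eq0 => AvC.
    by rewrite eqEsubset AvC subsetD1 CA !inE vA -ltnNge.
  have [wi|] := eqVneq w i; last by exists w.
  have [iv iA] : i != v /\ i \in A by move: iAv; rewrite !inE => /andP [].
  have ai : a < g i x by move: wAvC; rewrite wi !inE iA iv /= andbT -ltnNge.
  (* When [w] is [i] itself, a generator in whose lcm [i] attains its [x]-exponent replaces it. *)
  have [j jA ij] := bigmax_geP (leq_ltn_trans (leq0n _) ai) (coveredP _ _ _ ci x).
  move: jA; rewrite !inE => /and3P [ji jv jA]; exists j => //.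
  by rewrite !inE jA jv andbT /= andbT -ltnNge (leq_trans ai ij).
- rewrite (cardsD1 v A) vA /=.
  apply: (IHk _ _ _ ltx (supported_colon v sk)).
  by rewrite colon_kill; apply: two_covered_kill.
Qed.

Lemma in_ideal_two_covered g A :
  two_covered g A -> stanley_codim_le #|A|.-2.-1 (in_ideal g A).
Proof.
move=> tA; have [A2|A2] := leqP #|A| 2.
  have [i iA gi0] := two_covered_small tA A2.
  apply: (@stanley_codim_leW _ 0) => //; apply: stanley_codim_le_predT => m.
  apply/in_idealP; exists i => //; rewrite gi0.
  by apply/mnm_lepP => x; rewrite mnm0E.
have [[v [vA tv [i iAv ci]]] _] := two_covered_select tA (ltnW A2).
apply: (@stanley_codim_le_ext _ _ (ideal_diff g A set0)) => [m|].
  by rewrite /ideal_diff in_ideal0 andbT.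
apply: (ideal_diff_card2 _ vA _ iAv ci); rewrite ?sub0set ?inE //.
  move=> _; have /set0Pn [w wAvi] : A :\ v :\ i != set0.
    by rewrite -card_gt0; move: A2; rewrite (cardsD1 v A) vA (cardsD1 i (A :\ v)) iAv.
  by exists w; move: wAvi; rewrite !inE => /andP [].
have -> : #|A|.-2.-1 = #|A :\ v|.-2 by rewrite (cardsD1 v A) vA.
exact: ideal_compl_two_covered.
Qed.

End TwoCoveredBounds.

(** * Generators arranged in a tree *)

Section Trees.
Local Open Scope nat_scope.
Variables (n : nat) (T : finType) (e : rel T).
Hypothesis esym : symmetric e.
(** Absence of cycles: on a cycle through [v], the other vertices would form a connected set
    containing two neighbours of [v]. *)
Hypothesis e_acyclic : forall (C : {set T}) v u w, cut_connected e C ->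
  v \notin C -> u \in C -> w \in C -> e v u -> e v w -> u = w.
Implicit Types (g : T -> 'X_{1..n}) (B C : {set T}) (m : 'X_{1..n}).

Definition gen_divisors g m := [set v | (g v <= m)%MM].

(** A non-cut vertex [v] of [B] outside [C] is a leaf by acyclicity. Added last, it meets a
    principal colon ideal, and the hypotheses survive its removal. *)
Lemma ideal_diff_tree g B C : C \subset B ->
  (forall m, cut_connected e (gen_divisors g m :&: B)) ->
  cut_connected e B -> cut_connected e C ->
  stanley_codim_le 1 (ideal_diff g B C).
Proof.
have [k] := ubnP #|B|; elim: k => // k IHk in B * => ltk CB connd connB connC.
have [<-|CnB] := eqVneq C B; first exact: ideal_diffxx.
have pCB : C \proper B by rewrite properEneq CnB.
have [v] := cut_connected_noncut esym connB connC pCB.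
rewrite inE => /andP [vC vB] connBv.
have leaf : {in B :\ v &, forall u w, e v u -> e v w -> u = w}.
  by move=> u w uB wB; apply: (e_acyclic connBv) => //; rewrite !inE eqxx.
have CBv : C \subset B :\ v by rewrite subsetD1 CB.
rewrite -(setD1K vB); apply: ideal_diffU1 => //.
  apply: IHk => // [|m]; first by move: ltk; rewrite (cardsD1 v B) vB.
  have [vm|vm] := boolP (v \in gen_divisors g m); last first.
    suff -> : gen_divisors g m :&: (B :\ v) = gen_divisors g m :&: B by [].
    apply/setP => u; rewrite !in_setI !in_setD1; case: eqP => //= ->.
    by rewrite (negbTE vm).
  rewrite setIDA; apply: cut_connectedD1 => //; first by rewrite inE vm.
  move=> u w; rewrite in_setD1 in_setI => /and3P [uv _ uB].
  rewrite in_setD1 in_setI => /and3P [wv _ wB].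
  by apply: leaf; rewrite in_setD1 ?uv ?wv.
have [Bv0|/set0Pn [u uBv]] := eqVneq (B :\ v) set0.
  apply: (@stanley_codim_leW _ 0) => //; apply: stanley_codim_le_predT => m.
  by rewrite Bv0 /ideal_compl in_ideal0.
have [| | |a [h [av hB ha evh]]] := cut_connectedP _ _ connB [set v].
- by rewrite sub1set.
- by apply/set0Pn; exists v; rewrite inE.
- by apply: contraTneq uBv => <-; rewrite !inE andNb.
move: av ha; rewrite !inE => /eqP av hv; rewrite av in evh; clear a av.
have hBv : h \in B :\ v by rewrite !inE hv.
(* If another generator divides a multiple of [g v], the connected set of divisors of that multiple
   contains a neighbour of [v], necessarily [h]. *)
apply: (@stanley_codim_le_ext _ _ (ideal_compl (colon v g) [set h])); last first.
  by have := ideal_compl_card (colon v g) [set h]; rewrite cards1.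
move=> m; rewrite /ideal_compl !colon_ideal; congr (~~ _).
apply/idP/idP; first by apply: in_idealS; rewrite sub1set.
case/in_idealP => w wBv wm; apply/in_idealP; exists h; first by rewrite inE.
set D := gen_divisors g (g v + m)%MM :&: B.
have wD : w \in D by move: wBv; rewrite !inE wm => /andP [].
have vD : v \in D by rewrite !inE lem_addr.
have [| | |a [b [av bD ba eab]]] := cut_connectedP _ _ (connd (g v + m)%MM) [set v].
- by rewrite sub1set.
- by apply/set0Pn; exists v; rewrite inE.
- apply/eqP => Dv; move: wD wBv; rewrite /D -Dv !inE => /eqP ->.
  by rewrite eqxx.
move: av ba; rewrite !inE => /eqP av bv; rewrite av in eab; clear a av.
move: bD; rewrite !inE => /andP [bm bB].
by rewrite (leaf h b) // !inE bv.
Qed.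

Hypothesis connT : cut_connected e setT.

Lemma in_ideal_tree g : (forall m, cut_connected e (gen_divisors g m)) ->
  stanley_codim_le 1 (in_ideal g setT).
Proof.
move=> connd; apply: (@stanley_codim_le_ext _ _ (ideal_diff g setT set0)) => [m|].
  by rewrite /ideal_diff in_ideal0 andbT.
by apply: ideal_diff_tree; rewrite ?sub0set ?cut_connected0 // => m; rewrite setIT.
Qed.

(** Setting [x] to 1 removes the condition on [x], just as raising the exponent of [x] in [m] to the
    maximum does. *)
Lemma gen_divisors_kill g x m :
  gen_divisors (kill x g) m = gen_divisors g (set_exponent x (\max_v g v x) m).
Proof.
apply/setP => v; rewrite !inE (kill_le x g).
have -> : g v x <= set_exponent x (\max_v g v x) m x.
  by rewrite mnmE eqxx (bigD1 v) //= leq_maxl.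
rewrite andbT; apply/mnm_lepP/mnm_lepP => H y; have := H y; rewrite !mnmE.
  by case: eqP.
by case: eqP.
Qed.

Lemma ideal_compl_tree g : (forall m, cut_connected e (gen_divisors g m)) ->
  stanley_codim_le 2 (ideal_compl g setT).
Proof.
have [W] : exists W : {set 'I_n}, supported W g by exists setT => v x; rewrite inE.
have [k] := ubnP #|W|; elim: k => // k IHk in W g * => ltk sg connd.
have [T0|/set0Pn [v vT]] := eqVneq [set: T] set0.
  apply: (@stanley_codim_leW _ 0) => //; apply: stanley_codim_le_predT => m.
  by rewrite T0 /ideal_compl in_ideal0.
have [W0|/set0Pn [x xW]] := eqVneq W set0.
  by apply: (ideal_compl_gen0 _ vT); apply: supported_set0; rewrite -W0.
have conndk m : cut_connected e (gen_divisors (kill x g) m) by rewrite gen_divisors_kill.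
have sk := supported_kill (x := x) sg.
have ltx : #|W :\ x| < k by move: ltk; rewrite (cardsD1 x) xW.
apply: (ideal_compl_slice (x := x)) => // [|a]; first exact: IHk sk _.
apply: ideal_diff_tree => //; first by move=> m; rewrite setIT.
(* The truncation is the set of divisors of one monomial, with maximal exponents off [x]; hence it
   is connected. *)
have -> : [set v in [set: T] | g v x <= a] =
    gen_divisors g [multinom (if y == x then a else \max_v g v y) | y < n].
  apply/setP => u; rewrite !inE /=; apply/idP/mnm_lepP => [ua y|/(_ x)].
    rewrite mnmE; case: eqP => [->//|_]; by rewrite (bigD1 u) //= leq_maxl.
  by rewrite mnmE eqxx.
exact: connd.
Qed.

End Trees.

(** * Stanley decompositions from cones *)

Lemma mpoly_of_coeffs (n : nat) (K : fieldType) (h : 'X_{1..n} -> K)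
    (S : seq 'X_{1..n}) :
  (forall m, h m != 0 -> m \in S) -> exists f : {mpoly K[n]}, forall m, f@_m = h m.
Proof.
move=> hS; exists (\sum_(m <- undup S) h m *: 'X_[m]) => m; rewrite raddf_sum /=.
have [mS|mS] := boolP (m \in undup S).
  rewrite (bigD1_seq m) ?undup_uniq //= mcoeffZ mcoeffX eqxx mulr1.
  rewrite big1 ?addr0 // => m' /negbTE m'm.
  by rewrite mcoeffZ mcoeffX m'm mulr0.
have -> : h m = 0 by apply/eqP; apply: contraNT mS => /hS; rewrite mem_undup.
rewrite big_seq big1 // => m' m'S; rewrite mcoeffZ mcoeffX.
by case: eqP => [m'm|_]; rewrite ?mulr0 //; rewrite m'm (negbTE mS) in m'S.
Qed.

Lemma mcoeffMXE (n : nat) (K : fieldType) (f : {mpoly K[n]}) (a m : 'X_{1..n}) :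
  (f * 'X_[a])@_m = if (a <= m)%MM then f@_(m - a) else 0.
Proof.
case: ifP => [am|Nam]; first by rewrite -{1}(submK am) addmC mcoeffMX.
apply: memN_msupp_eq0; rewrite (perm_mem (msuppMX _ _)).
apply/negP => /mapP [m' _ mE].
by rewrite mE lem_addr in Nam.
Qed.

Section StanleyOfCones.
Variables (n : nat) (K : fieldType) (M : lmodType {mpoly K[n]}) (gr : grading M).
(** Common setting for S/I and I: the [mono a] with [a] in [E] form a homogeneous K-basis of [M],
    and [coef] gives the coordinates. *)
Variables (E : pred 'X_{1..n}) (coef : M -> 'X_{1..n} -> K) (mono : 'X_{1..n} -> M).
Hypothesis coefL : forall c u v m, E m ->
  coef (c%:MP *: u + v) m = c * coef u m + coef v m.
Hypothesis coef_inj : forall u, (forall m, E m -> coef u m = 0) -> u = 0.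
Hypothesis coef_mono : forall f a m, E a -> E m ->
  coef (f *: mono a) m = (f * 'X_[a])@_m.
Hypothesis coef_fin : forall u, exists S : seq 'X_{1..n},
  forall m, E m -> coef u m != 0 -> m \in S.
Hypothesis gr_mono : forall a, E a -> exists b, gr b (mono a).
Hypothesis gr0 : forall a, gr a 0.
Hypothesis grD : forall a u v, gr a u -> gr a v -> gr a (u + v).

Lemma coefD u v m : E m -> coef (u + v) m = coef u m + coef v m.
Proof. by move=> Em; have := coefL 1 u v Em; rewrite mpolyC1 scale1r mul1r. Qed.

Lemma coef0 m : E m -> coef 0 m = 0.
Proof.
move=> Em; have := coefD 0 0 Em; rewrite addr0 => H.
by apply: (@addrI _ (coef 0 m)); rewrite addr0 -H.
Qed.

Lemma coefB u v m : E m -> coef (u - v) m = coef u m - coef v m.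
Proof.
move=> Em; apply/eqP; rewrite eq_sym subr_eq; apply/eqP.
by rewrite -coefD // subrK.
Qed.

Lemma coef_sum (I : finType) (F : I -> M) m : E m ->
  coef (\sum_i F i) m = \sum_i coef (F i) m.
Proof.
move=> Em; elim/big_ind2: _ => [|u x v y <- <-|//]; first exact: coef0.
exact: coefD.
Qed.

(** A cone [(a, Z)] becomes the Stanley space of [mono a] over K[Z]; the isomorphism onto [M] is
    addition. *)
Lemma spdim_of_cones p : stanley_codim_le p E -> (spdim gr <= p)%N.
Proof.
move=> [s sp sE]; pose r := size s.
pose c0 : 'X_{1..n} * {set 'I_n} := (0%MM, set0).
pose c (i : 'I_r) := nth c0 s i.
pose lam i := mono (c i).1; pose Z i := (c i).2.
have cs i : c i \in s by apply: mem_nth.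
have countE m : (\sum_(i < r) in_cone (c i) m = E m)%N.
  rewrite -sE -sum1_count [RHS]big_mkcond /= (big_nth c0) big_mkord.
  by apply: eq_bigr => i _; rewrite /c; case: in_cone.
have coneE i m : in_cone (c i) m -> E m.
  by move=> cm; have := countE m; rewrite (bigD1 i) //= cm; case: (E m).
have cone1 i j m : in_cone (c i) m -> in_cone (c j) m -> i = j.
  move=> im jm; apply/eqP; apply: contraT => ij; have := countE m.
  rewrite (bigD1 i) //= (bigD1 j) /=; last by rewrite eq_sym.
  by rewrite im jm; case: (E m).
have apex i : in_cone (c i) (c i).1 by apply/in_coneP.
have Elam i : E (c i).1 := coneE i _ (apex i).
have inZ i (f : {mpoly K[n]}) m : poly_in (Z i) f -> f@_m != 0 -> in_cone (c i) (m + (c i).1)%MM.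
  move=> fZ fm; apply/in_coneP => x; rewrite mnmDE leq_addl; split=> // xZ.
  by rewrite (fZ m) // mcoeff_msupp.
have coef_cone i f m : poly_in (Z i) f -> E m -> coef (f *: lam i) m != 0 ->
    in_cone (c i) m.
  move=> fZ Em; rewrite coef_mono // mcoeffMXE; case: ifP => [am|]; last by rewrite eqxx.
  by move=> /(inZ i _ _ fZ); rewrite submK.
have dec : is_stanley_decomposition gr lam Z.
  split=> [i|].
    split; first exact: gr_mono.
    move=> f fZ flam; apply/mpolyP => m; rewrite mcoeff0; apply/eqP.
    apply: contraT => fm; have Em := coneE _ _ (inZ i f m fZ fm).
    have := coef_mono f (Elam i) Em; rewrite flam coef0 // mcoeffMXE lem_addl addmK.
    by move=> f0; rewrite -f0 eqxx in fm.
  exists (fun u : {ffun 'I_r -> M} => \sum_i u i); split=> [a u v _ _|a u _ gu|x].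
  - rewrite scaler_sumr -big_split /=; apply: eq_bigr => i _.
    by rewrite !ffunE.
  - by apply: big_ind => [||i _]; [apply: gr0 | apply: grD | apply: gu].
  - have [S HS] := coef_fin x.
    (* [f i] collects the coordinates of [x] in the [i]-th cone, moved to the origin. *)
    have hf (i : 'I_r) : exists f : {mpoly K[n]}, forall t, f@_t =
        if in_cone (c i) (t + (c i).1)%MM then coef x (t + (c i).1)%MM else 0.
      apply: (@mpoly_of_coeffs _ _ _ [seq (m - (c i).1)%MM | m <- S]) => t.
      case: ifP => [tc xt|]; last by rewrite eqxx.
      by apply/mapP; exists (t + (c i).1)%MM; rewrite ?addmK // HS // (coneE i).
    have [f Hf] := boolp.choice hf.
    have fZ i : poly_in (Z i) (f i).
      move=> m; rewrite mcoeff_msupp Hf; case: ifP => [/in_coneP cm _ y yZ|].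
        by have [_ /(_ yZ)] := cm y; rewrite mnmDE; lia.
      by rewrite eqxx.
    have sumx : \sum_i f i *: lam i = x.
      apply/eqP; rewrite -subr_eq0; apply/eqP; apply: coef_inj => m Em.
      rewrite coefB // coef_sum //.
      suff -> : \sum_i coef (f i *: lam i) m = \sum_(i < r) (in_cone (c i) m)%:R * coef x m.
        by rewrite -mulr_suml -natr_sum countE Em mul1r subrr.
      apply: eq_bigr => i _; rewrite coef_mono // mcoeffMXE Hf.
      case: ifP => [am|Nam]; first by rewrite submK //; case: in_cone; rewrite ?mul1r ?mul0r.
      by rewrite /in_cone Nam mul0r.
    exists [ffun i => f i *: lam i]; split.
      split=> [i|]; first by exists (f i); rewrite ?ffunE.
      by rewrite -[RHS]sumx; apply: eq_bigr => i _; rewrite ffunE.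
    move=> u [Du xE]; apply/ffunP => i; rewrite ffunE.
    apply/eqP; rewrite -subr_eq0; apply/eqP.
    (* Uniqueness: the [w j] sum to zero and have their coordinates in disjoint cones. *)
    pose w j := f j *: lam j - u j.
    have w0 : \sum_j w j = 0 by rewrite big_split /= sumrN xE sumx subrr.
    have wcone j m : E m -> coef (w j) m != 0 -> in_cone (c j) m.
      have [h hZ uE] := Du j; move=> Em; rewrite /w uE -scalerBl.
      apply: coef_cone => //.
      move=> t; rewrite mcoeff_msupp mcoeffB => tfh y yZ.
      have [ft|ft] := eqVneq (f j)@_t 0.
        by apply: (hZ t) => //; rewrite mcoeff_msupp; apply: contraNneq tfh => ->; rewrite ft subr0.
      by apply: (fZ j t) => //; rewrite mcoeff_msupp.
    apply: coef_inj => m Em; apply/eqP; apply: contraT => wi.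
    have im := wcone i m Em wi; have := coef_sum w Em; rewrite w0 coef0 //.
    rewrite (bigD1 i) //= big1 ?addr0 => [w0'|j ji]; first by rewrite /w -w0' eqxx in wi.
    apply/eqP; apply: contraNT ji => /(wcone j m Em) jm; apply/eqP.
    exact: cone1 jm im.
have depth_n : (stanley_depth Z <= n)%N.
  rewrite /stanley_depth; apply: (big_rec (fun d => d <= n)%N) => // i d _ dn.
  by rewrite geq_min dn orbT.
have depth_p : (n - p <= stanley_depth Z)%N.
  rewrite /stanley_depth; apply: (big_rec (fun d => n - p <= d)%N) => [|i d _ dn].
    exact: leq_subr.
  by rewrite leq_min dn andbT (allP sp _ (cs i)).
rewrite /spdim leq_subLR addnC -leq_subLR; apply: leq_trans depth_p _.
rewrite /sdepth; have ltn : (stanley_depth Z < n.+1)%N by [].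
apply: (bigmax_sup (Ordinal ltn)) => //=.
by apply/boolp.asboolP; exists r, lam, Z.
Qed.

End StanleyOfCones.

Section QuotProj.
Variables (R : comNzRingType) (I : idealr R).

Lemma quot_proj_eq a b : quot_proj I a = quot_proj I b <-> a - b \in I.
Proof.
have E := @generic_quotient.eqquotP _ _ {ideal_quot I} a b.
by rewrite -Quotient.equivE; split=> [|/E]; [move/E | ].
Qed.

Lemma quot_proj_eq0 a : quot_proj I a = 0 <-> a \in I.
Proof.
have -> : 0 = quot_proj I 0 by rewrite /quot_proj raddf0.
by rewrite quot_proj_eq subr0.
Qed.

Lemma quot_projD a b : quot_proj I (a + b) = quot_proj I a + quot_proj I b.
Proof. exact: raddfD. Qed.

Lemma quot_projM a b : quot_proj I (a * b) = a *: quot_proj I b.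
Proof. exact: rmorphM. Qed.

Lemma quot_proj_repr (u : {ideal_quot I}) : quot_proj I (generic_quotient.repr u) = u.
Proof. exact: generic_quotient.reprK. Qed.

End QuotProj.

Section IdealVal.
Variables (R : comNzRingType) (I : idealr R).
Implicit Types u v : ideal_mod I.

Lemma ideal_valD u v : (ideal_val (u + v) : R) = ideal_val u + ideal_val v.
Proof. by []. Qed.

Lemma ideal_valZ a u : (ideal_val (a *: u) : R) = a * ideal_val u.
Proof. by []. Qed.

End IdealVal.

(** * Stanley decompositions of S/I and I *)

Section MonomialIdealModules.
Variables (n : nat) (K : fieldType) (I : idealr {mpoly K[n]}) (G : seq 'X_{1..n}).
Hypothesis genI : generates (fun m => m \in G) I.

Definition generator (i : 'I_(size G)) : 'X_{1..n} := nth 0%MM G i.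

Lemma mem_monomial_ideal p :
  p \in I <-> forall m, m \in msupp p -> in_ideal generator setT m.
Proof.
split=> [/(genI _).1 [s [sG ->]] m|H].
  rewrite mcoeff_msupp raddf_sum /= => sm.
  have [x xs xm] : exists2 x, x \in s & (x.1 * 'X_[x.2])@_m != 0.
    apply: boolp.contrapT => N; case/eqP: sm; rewrite big_seq big1 // => x xs.
    by apply/eqP; apply: contraT => xm; case: N; exists x.
  move: xm; rewrite mcoeffMXE; case: ifP => [le _|]; last by rewrite eqxx.
  have ltx : (index x.2 G < size G)%N by rewrite index_mem sG.
  by apply/in_idealP; exists (Ordinal ltx); rewrite ?inE // /generator nth_index // sG.
rewrite (mpolyE p) big_seq; apply: rpred_sum => m /H /in_idealP [i _ im].
rewrite -mul_mpolyC; apply: idealMr; apply/genI.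
exists [:: ('X_[m - generator i], generator i)]; split.
  by move=> x; rewrite inE => /eqP ->; apply: mem_nth.
by rewrite big_seq1 /= -mpolyXD submK.
Qed.

Lemma spdim_quot p : stanley_codim_le p (ideal_compl generator setT) ->
  (spdim (@quot_gr n K I) <= p)%N.
Proof.
pose coef (u : {ideal_quot I}) m := (generic_quotient.repr u)@_m.
(* Two representatives differ by an element whose monomials all lie in the ideal. *)
have coefE m q : ideal_compl generator setT m -> coef (quot_proj I q) m = q@_m.
  move=> /negP mI; apply/eqP; rewrite -subr_eq0 -mcoeffB; apply: contraPT mI => Hm H.
  apply: H; have /quot_proj_eq/mem_monomial_ideal : quot_proj I
    (generic_quotient.repr (quot_proj I q)) = quot_proj I q by exact: quot_proj_repr.
  by apply; rewrite mcoeff_msupp.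
apply: (@spdim_of_cones _ _ _ _ _ coef (fun a => quot_proj I 'X_[a])).
- move=> c u v m Em; rewrite -{1}[u]quot_proj_repr -{1}[v]quot_proj_repr.
  by rewrite -quot_projM -quot_projD coefE // mcoeffD mcoeffCM.
- move=> u u0; rewrite -[u]quot_proj_repr; apply/quot_proj_eq0.
  apply/mem_monomial_ideal => m; rewrite mcoeff_msupp; apply: contraNT => mI.
  by apply/eqP; apply: u0.
- by move=> f a m _ Em; rewrite -quot_projM coefE.
- by move=> u; exists (msupp (generic_quotient.repr u)) => m _; rewrite mcoeff_msupp.
- move=> a _; exists (fun i => (a i)%:Z); exists 'X_[a] => // m.
  by rewrite msuppX inE => /eqP ->.
- by move=> a; exists 0; rewrite ?msupp0 //; [move=> m; rewrite msupp0 | rewrite /quot_proj raddf0].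
- move=> a u v [p1 gp1 ->] [p2 gp2 ->]; exists (p1 + p2); last by rewrite quot_projD.
  by move=> m /msuppD_le; rewrite mem_cat => /orP [/gp1|/gp2].
Qed.

Lemma spdim_ideal p : stanley_codim_le p (in_ideal generator setT) ->
  (spdim (@ideal_gr n K I) <= p)%N.
Proof.
have monoI a : exists u : ideal_mod I, in_ideal generator setT a ->
    ideal_val u = 'X_[a].
  have [aI|_] := boolP (in_ideal generator setT a); last by exists 0.
  have XI : ('X_[a] : {mpoly K[n]}) \in I.
    by apply/mem_monomial_ideal => m; rewrite msuppX inE => /eqP ->.
  by exists (IdealMod XI).
have [mono monoE] := boolp.choice monoI.
apply: (@spdim_of_cones _ _ _ _ _ (fun u m => (ideal_val u : {mpoly K[n]})@_m) mono).
- by move=> c u v m _; rewrite ideal_valD ideal_valZ mcoeffD mcoeffCM.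
- move=> u u0; apply: val_inj; apply/mpolyP => m; rewrite mcoeff0.
  have [mI|mI] := boolP (in_ideal generator setT m); first exact: u0.
  apply: memN_msupp_eq0; apply: contra mI; apply: (mem_monomial_ideal _).1.
  exact: ideal_valP.
- by move=> f a m Ea _; rewrite ideal_valZ monoE.
- by move=> u; exists (msupp (ideal_val u : {mpoly K[n]})) => m _; rewrite mcoeff_msupp.
- move=> a aI; exists (fun i => (a i)%:Z); rewrite /ideal_gr monoE // => m.
  by rewrite msuppX inE => /eqP ->.
- by move=> a m; rewrite msupp0.
- move=> a u v gu gv m /=.
  by move=> /msuppD_le; rewrite mem_cat => /orP [/gu|/gv].
Qed.

End MonomialIdealModules.

(** * Projective resolutions *)

Definition mk_linear (R : nzRingType) (U V : lmodType R) (f : U -> V)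
    (lin_f : linear f) : {linear U -> V} :=
  HB.pack f (GRing.isLinear.Build R U V *:%R f lin_f).

(** Builds chain maps and homotopies degree by degree; the invariant [Q] guarantees that the next
    step exists. *)
Lemma dependent_choice_seq (X : nat -> Type) (Q : forall i, X i -> Prop)
    (S : forall i, X i -> X i.+1 -> Prop) (x0 : X 0%N) :
  Q 0%N x0 -> (forall i x, Q i x -> exists y, S i x y /\ Q i.+1 y) ->
  exists a : forall i, X i, a 0%N = x0 /\ forall i, S i (a i) (a i.+1).
Proof.
move=> Q0 step.
have next i (x : {x : X i | Q i x}) : {y : {y : X i.+1 | Q i.+1 y} | S i (sval x) (sval y)}.
  apply: boolp.constructive_indefinite_description.
  by case: x => x Qx; have [y [xy Qy]] := step i x Qx; exists (exist _ y Qy).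
pose a := nat_rect (fun i => {x : X i | Q i x}) (exist _ x0 Q0)
  (fun i x => sval (next i x)).
exists (fun i => sval (a i)); split=> // i; exact: (svalP (next i (a i))).
Qed.

Section Pullback.
Variables (R : nzRingType) (P M N : lmodType R).
Variables (f : {linear P -> N}) (g : {linear M -> N}).

Record pullback := Pullback
  { pullback_val : P * M; pullback_eq : f pullback_val.1 == g pullback_val.2 }.

HB.instance Definition _ := [isSub for pullback_val].
HB.instance Definition _ := [Choice of pullback by <:].

Lemma pullback_submod_closed :
  submod_closed [pred u : P * M | f u.1 == g u.2].
Proof.
split=> [|a u v]; rewrite !inE /=; first by rewrite !raddf0.
by move=> /eqP fu /eqP fv; rewrite !linearP fu fv.
Qed.

HB.instance Definition _ := GRing.SubChoice_isSubLmodule.Build R (P * M)%type _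
  pullback pullback_submod_closed.

Lemma pullback_fst_linear : linear (fun u : pullback => (pullback_val u).1).
Proof. by []. Qed.

Lemma pullback_snd_linear : linear (fun u : pullback => (pullback_val u).2).
Proof. by []. Qed.

(* The definition of [projective] only lifts along surjections; lift the
   identity of [P] along the projection from the pullback instead. *)
Lemma projective_lift : projective P ->
  (forall y, exists x, g x = f y) ->
  exists h : {linear P -> M}, forall x, g (h x) = f x.
Proof.
move=> projP fg.
have [y|s sK] := projP _ _ (mk_linear pullback_fst_linear) idfun.
  have [x gx] := fg y; have fgx : f (y, x).1 == g (y, x).2 by rewrite gx.
  by exists (Pullback fgx).
exists (mk_linear pullback_snd_linear \o s) => x /=.
by rewrite -(eqP (pullback_eq (s x))); congr (f _); exact: sK.
Qed.

End Pullback.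

Section Comparison.
Variables (R : nzRingType) (M : lmodType R).

Definition exact_seq (T : nat -> lmodType R) (e : {linear T 0%N -> M})
    (d : forall i, {linear T i.+1 -> T i}) : Prop :=
  [/\ forall y, exists x, e x = y,
      forall x, e x = 0 <-> exists y, d 0%N y = x
    & forall i x, d i x = 0 <-> exists y, d i.+1 y = x].

Variables (P : nat -> lmodType R) (eP : {linear P 0%N -> M}).
Variable dP : forall i, {linear P i.+1 -> P i}.
Variables (T : nat -> lmodType R) (eT : {linear T 0%N -> M}).
Variable dT : forall i, {linear T i.+1 -> T i}.
Hypothesis projP : forall i, projective (P i).
Hypotheses (exactP : exact_seq eP dP) (exactT : exact_seq eT dT).

Lemma chain_map_exists : exists a : forall i, {linear P i -> T i},
  (forall x, eT (a 0%N x) = eP x) /\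
  forall i x, dT i (a i.+1 x) = a i (dP i x).
Proof.
have [_ eP0 dP0] := exactP; have [eTsurj eT0 dT0] := exactT.
have [|a0 a0E] := @projective_lift _ _ _ _ eP eT (@projP 0%N); first by [].
have [|i a ad|a [a0' aE]] := @dependent_choice_seq (fun i => {linear P i -> T i})
  (fun i a => forall y, exists x, dT i x = a (dP i y))
  (fun i a a' => forall x, dT i (a' x) = a (dP i x)) a0.
- by move=> y; apply/eT0; rewrite a0E; apply/eP0; exists y.
- have [|a' a'E] := @projective_lift _ _ _ _ (a \o dP i) (dT i) (@projP i.+1).
    exact: ad.
  exists a'; split=> // y; apply/dT0; rewrite a'E /=.
  suff -> : dP i (dP i.+1 y) = 0 by rewrite raddf0.
  by apply/dP0; exists y.
- by exists a; split=> // x; rewrite a0' a0E.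
Qed.

Lemma null_homotopy (c : forall i, {linear P i -> T i}) :
  (forall x, eT (c 0%N x) = 0) -> (forall i x, dT i (c i.+1 x) = c i (dP i x)) ->
  exists h : forall i, {linear P i -> T i.+1},
    forall i x, c i.+1 x = dT i.+1 (h i.+1 x) + h i (dP i x).
Proof.
move=> c0 cE; have [_ eP0 dP0] := exactP; have [_ eT0 dT0] := exactT.
have [|h0 h0E] := @projective_lift _ _ _ _ (c 0%N) (dT 0%N) (@projP 0%N).
  by move=> y; apply/eT0.
have [|i h hE|h [_ hE]] := @dependent_choice_seq (fun i => {linear P i -> T i.+1})
  (fun i h => forall x, dT i (c i.+1 x) = dT i (h (dP i x)))
  (fun i h h' => forall x, c i.+1 x = dT i.+1 (h' x) + h (dP i x)) h0.
- by move=> x; rewrite cE h0E.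
- have [|h' h'E] := @projective_lift _ _ _ _ (c i.+1 \- (h \o dP i)) (dT i.+1) (@projP i.+1).
    by move=> y; apply/dT0; rewrite /= raddfB /= hE subrr.
  exists h'; split=> x; first by rewrite h'E /= subrK.
  rewrite h'E /= cE; suff -> : dP i (dP i.+1 x) = 0 by rewrite raddf0 subr0.
  by apply/dP0; exists x.
- by exists h => i x; apply: hE.
Qed.

End Comparison.

(** Compare [T] with a resolution [P] of length [p] in both directions. The identity minus the
    composite through [P] is null-homotopic, and the composite vanishes above degree [p] because [P]
    does. *)
Lemma proj_dim_homotopy (R : nzRingType) (M : lmodType R) (p : nat)
    (T : nat -> lmodType R) (eT : {linear T 0%N -> M})
    (dT : forall i, {linear T i.+1 -> T i}) :
  has_proj_resolution M p -> (forall i, projective (T i)) -> exact_seq eT dT ->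
  exists h : forall i, {linear T i -> T i.+1},
    forall i x, (p <= i)%N -> x = dT i.+1 (h i.+1 x) + h i (dT i x).
Proof.
move=> [P [eP [dP [projP P0 eP1 eP2 eP3]]]] projT exT.
have exP : exact_seq eP dP by split.
have [a [a0 aE]] := chain_map_exists projT exT exP.
have [b [b0 bE]] := chain_map_exists projP exP exT.
have [||h hE] := null_homotopy projT exT exT (c := fun i => idfun \- (b i \o a i)).
- by move=> x; rewrite /= raddfB /= b0 a0 subrr.
- by move=> i x; rewrite /= raddfB /= bE aE.
exists h => i x pi; rewrite -hE /=.
by rewrite (P0 i.+1 pi (a i.+1 x)) raddf0 subr0.
Qed.

Lemma projective_regular (R : nzRingType) : projective (R^o : lmodType R).
Proof.
move=> M N g f gsurj; have [m gm] := gsurj (f 1).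
have lin : linear (fun a : R^o => (a : R) *: m).
  by move=> a u v; rewrite scalerDl scalerA.
exists (mk_linear lin) => x /=; rewrite linearZ gm -linearZ /=; congr (f _).
exact: mulr1.
Qed.

Definition ffun_delta (R : nzRingType) (I : finType) (i : I) : {ffun I -> R^o} :=
  [ffun j => (j == i)%:R].

Lemma ffun_delta_sum (R : nzRingType) (I : finType) (u : {ffun I -> R^o}) :
  u = \sum_i (u i : R) *: ffun_delta R i.
Proof.
apply/ffunP => j; rewrite sum_ffunE (bigD1 j) //= big1 => [|i ij].
  by rewrite !ffunE eqxx addr0; apply/esym/mulr1.
by rewrite !ffunE eq_sym (negbTE ij); apply: mulr0.
Qed.

Lemma ffun_lift_linear (R : nzRingType) (I : finType) (V : lmodType R) (m : I -> V) :
  linear (fun u : {ffun I -> R^o} => \sum_i (u i : R) *: m i).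
Proof.
move=> a u v; rewrite scaler_sumr -big_split /=; apply: eq_bigr => i _.
by rewrite !ffunE scalerDl scalerA.
Qed.

Lemma projective_ffun (R : nzRingType) (I : finType) :
  projective ({ffun I -> R^o} : lmodType R).
Proof.
move=> M N g f gsurj.
have [m gm] := boolp.choice (fun i : I => gsurj (f (ffun_delta R i))).
exists (mk_linear (ffun_lift_linear m)) => u /=; rewrite [in RHS](ffun_delta_sum u) !raddf_sum /=.
by apply: eq_bigr => i _; rewrite !linearZ gm.
Qed.

(** The resolution of [I] is spliced with the inclusion of [I] into [R], hence the shift by one. *)
Lemma quot_resolution (R : comNzRingType) (I : idealr R) (q : nat) :
  has_proj_resolution (ideal_mod I) q -> has_proj_resolution {ideal_quot I} q.+1.
Proof.
move=> [P [e [f [projP P0 esurj e0 f0]]]].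
have lin0 : linear (fun a : R^o => quot_proj I a).
  by move=> a u v; rewrite quot_projD -quot_projM.
have lin1 : linear (fun u : P 0%N => ideal_val (e u)).
  by move=> a u v; rewrite linearP.
pose P' i : lmodType R := if i is j.+1 then P j else R^o.
pose f' i : {linear P' i.+1 -> P' i} :=
  match i return {linear P' i.+1 -> P' i} with
  | 0%N => mk_linear lin1 | j.+1 => f j end.
exists P', (mk_linear lin0), f'; split.
- by case=> [|i]; [apply: projective_regular | apply: projP].
- by case=> [//|i]; rewrite ltnS; apply: P0.
- by move=> y; exists (generic_quotient.repr y); apply: quot_proj_repr.
- move=> x; rewrite quot_proj_eq0; split=> [xI|[y <-]]; last exact: ideal_valP.
  by have [y ey] := esurj (IdealMod xI); exists y; rewrite /= ey.
- case=> [|i] x /=; last exact: f0.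
  rewrite -e0; split=> [ex|->]; last by [].
  by apply: val_inj.
Qed.

(** * The Taylor resolution *)

Section AlternatingSums.
Variables (k : nat) (V : zmodType).

(** Pairs with i < j are matched with their transposes, which works in every characteristic. *)
Lemma sum_antisym (Q : rel 'I_k) (a : 'I_k -> 'I_k -> V) :
  (forall i j, Q i j = Q j i) -> (forall i, ~~ Q i i) ->
  (forall i j, Q i j -> a i j = - a j i) ->
  \sum_i \sum_(j | Q i j) a i j = 0.
Proof.
move=> Qsym Qirr aanti; rewrite pair_big_dep /=.
rewrite (bigID (fun p : 'I_k * 'I_k => (p.1 < p.2)%N)) /=.
rewrite [X in _ + X](reindex (fun p : 'I_k * 'I_k => (p.2, p.1))) /=; last first.
  by exists (fun p => (p.2, p.1)) => -[].
rewrite [X in _ + X](eq_big (fun p : 'I_k * 'I_k => Q p.1 p.2 && (p.1 < p.2)%N)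
  (fun p => - a p.1 p.2)); first by rewrite sumrN subrr.
  move=> [i j] /=; rewrite Qsym; case: (boolP (Q i j)) => //= Qij.
  rewrite -leqNgt leq_eqVlt; case: eqP => //= /val_inj ij.
  by rewrite ij (negbTE (Qirr _)) in Qij.
by move=> [i j] /= /andP [Qji _]; apply: aanti.
Qed.

End AlternatingSums.

Section SimplicialBoundary.
Variables (K : fieldType) (k : nat) (V : lmodType K).
Implicit Types (F G : {set 'I_k}) (W : {set 'I_k} -> V).

(** The parity of the position of [j] in [j |: F]: the sign of the face [F] in its boundary. *)
Definition inv_parity (j : 'I_k) F : bool := odd #|[set a in F | (a < j)%N]|.

Lemma inv_parityU1 j l F : l \notin F ->
  inv_parity j (l |: F) = inv_parity j F (+) (l < j)%N.
Proof.
move=> lF; rewrite /inv_parity; have [lj|jl] := ltnP l j.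
  rewrite (_ : [set a in _ | _] = l |: [set a in F | (a < j)%N]).
    by rewrite cardsU1 inE (negbTE lF) /= addbT.
  by apply/setP => a; rewrite !inE; case: eqP => [->|].
rewrite addbF; congr (odd _); apply: eq_card => a; rewrite !inE.
by case: eqP => [->|] //; rewrite (negbTE lF) ltnNge jl.
Qed.

(** The simplicial boundary of the chain with coefficients [W], read off at the face [G]. *)
Definition boundary W G : V := \sum_(j | j \notin G) (-1) ^+ inv_parity j G *: W (j |: G).

Lemma boundary_boundary W G : boundary (boundary W) G = 0.
Proof.
rewrite /boundary.
under eq_bigr => j _ do rewrite scaler_sumr.
pose a (j l : 'I_k) : V := (-1) ^+ inv_parity j G *:
  ((-1) ^+ inv_parity l (j |: G) *: W (l |: (j |: G))).
rewrite big_mkcond /=.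
rewrite (eq_bigr (fun j => \sum_(l | [&& j \notin G, l \notin G & j != l]) a j l)).
  apply: sum_antisym => [i j|i|i j /and3P [iG jG ij]].
  - by rewrite andbCA eq_sym.
  - by rewrite eqxx !andbF.
  - rewrite /a !scalerA !inv_parityU1 // setUCA -scaleNr; congr (_ *: _).
    rewrite !signr_addb; case: (ltngtP i j) => [||/val_inj eij].
    + by rewrite !mulr1 mulrN1 mulrN mulrC.
    + by rewrite !mulr1 mulrN1 mulrN opprK mulrC.
    + by rewrite eij eqxx in ij.
move=> j _; case: ifP => [jG|jG]; last by rewrite big_pred0.
by apply: eq_bigl => l; rewrite !inE negb_or andbC eq_sym.
Qed.

(* Contraction of the simplex on [X] towards its least vertex. *)
Lemma boundary_contraction W (X : {set 'I_k}) v : v \in X ->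
  {in X, forall i : 'I_k, (v <= i)%N} -> (forall F, W F != 0 -> F \subset X) ->
  (forall G, boundary W G = 0) ->
  forall G, boundary (fun F => if v \in F then W (F :\ v) else 0) G = W G.
Proof.
move=> vX vmin WX W0 G.
have sign0 F : v \notin F -> W F != 0 \/ W (v |: F) != 0 -> inv_parity v F = false.
  move=> vF WF; have FX : F \subset X.
    by case: WF => /WX //; apply: subset_trans; apply: subsetUr.
  rewrite /inv_parity (_ : [set a in F | _] = set0) ?cards0 //.
  apply/setP => a; rewrite !inE; apply/negP => /andP [aF].
  by rewrite ltnNge vmin // (subsetP FX).
rewrite /boundary; have [vG|vG] := boolP (v \in G); last first.
  rewrite (bigD1 v) //= big1 ?addr0 => [|j /andP [jG jv]].
    rewrite setU11 setU1K //; have [->|WG] := eqVneq (W G) 0; first by rewrite scaler0.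
    by rewrite sign0 ?scale1r //; left.
  by rewrite !inE eq_sym (negbTE jv) (negbTE vG) scaler0.
have := W0 (G :\ v); rewrite /boundary (bigD1 v) /=; last by rewrite !inE eqxx.
rewrite setD1K //; have -> : (-1) ^+ inv_parity v (G :\ v) *: W G = W G.
  have [->|WG] := eqVneq (W G) 0; first by rewrite scaler0.
  by rewrite sign0 ?scale1r // ?setD11 //; right; rewrite setD1K.
move/eqP; rewrite addr_eq0 => /eqP ->; rewrite -sumrN; apply: eq_big => [j|j jG].
  by rewrite !inE; case: (eqVneq j v) => [->|_] /=; rewrite ?vG ?andbT ?andbF.
have jv : j != v by apply: contraNneq jG => ->.
have -> : (j |: G) :\ v = j |: G :\ v.
  by apply/setP => a; rewrite !inE; case: (eqVneq a v) => [->|] //=; rewrite eq_sym (negbTE jv).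
rewrite !inE vG orbT -scaleNr.
have [->|Wj] := eqVneq (W (j |: G :\ v)) 0; first by rewrite !scaler0.
congr (_ *: _); rewrite -{1}(setD1K vG) inv_parityU1 ?setD11 //.
have jX : j \in X by apply: (subsetP (WX _ Wj)); rewrite setU11.
have -> : (v < j)%N by rewrite ltn_neqAle vmin // andbT eq_sym.
by rewrite signr_addb mulrN1.
Qed.

End SimplicialBoundary.

Section Taylor.
Variables (K : fieldType) (n k : nat) (g : 'I_k -> 'X_{1..n}).
Local Notation S := {mpoly K[n]}.
Implicit Types (F G : {set 'I_k}) (m : 'X_{1..n}).

Definition lcm_gen F : 'X_{1..n} := [multinom \max_(v in F) g v x | x < n].

Lemma lcm_gen_le F m : reflect {in F, forall v, (g v <= m)%MM} (lcm_gen F <= m)%MM.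
Proof.
apply: (iffP mnm_lepP) => [H v vF|H x].
  by apply/mnm_lepP => x; apply: leq_trans (H x); rewrite mnmE (bigmax_sup v).
by rewrite mnmE; apply/bigmax_leqP => v /H /mnm_lepP.
Qed.

Lemma lcm_genS F G : F \subset G -> (lcm_gen F <= lcm_gen G)%MM.
Proof.
move=> /subsetP FG; apply/lcm_gen_le => v /FG vG.
by apply/(lcm_gen_le G _): vG; apply: lepm_refl.
Qed.

Lemma le_lcm_gen F v : v \in F -> (g v <= lcm_gen F)%MM.
Proof. by move=> vF; apply/(lcm_gen_le F _): vF; apply: lepm_refl. Qed.

Lemma lcm_genU1_eq F j : (lcm_gen (j |: F) - lcm_gen F == 0)%MM = covered g F j.
Proof.
apply/eqP/coveredP => [H x|H].
  have /mnmP /(_ x) := H; rewrite mnmBE mnm0E => /eqP; rewrite subn_eq0 !mnmE.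
  by apply: leq_trans; rewrite (bigmax_sup j) ?setU11.
apply/mnmP => x; rewrite mnmBE mnm0E; apply/eqP; rewrite subn_eq0 !mnmE.
by apply/bigmax_leqP => v /setU1P [->|vF]; rewrite ?H // (bigmax_sup v).
Qed.

Lemma lcm_genK F G : F \subset G ->
  'X_[lcm_gen G - lcm_gen F] * 'X_[lcm_gen F] = 'X_[lcm_gen G] :> S.
Proof. by move=> FG; rewrite -mpolyXD submK ?lcm_genS. Qed.

Definition taylor_index i := {F : {set 'I_k} | #|F| == i}.

Definition taylor_module i : lmodType S := {ffun taylor_index i -> S^o}.

(** Extending coordinates by 0 to subsets of all sizes keeps size proofs out of the sums over
    faces. *)
Definition taylor_coef i (u : taylor_module i) F : S :=
  if insub F is Some F' then u F' else 0.

Lemma taylor_coef_val i (u : taylor_module i) (F : taylor_index i) :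
  taylor_coef u (val F) = u F.
Proof. by rewrite /taylor_coef valK. Qed.

Lemma taylor_coef_card i (u : taylor_module i) F :
  #|F| != i -> taylor_coef u F = 0.
Proof. by move=> Fi; rewrite /taylor_coef insubN. Qed.

Lemma taylor_coefP i (a : S) (u v : taylor_module i) F :
  taylor_coef (a *: u + v) F = a * taylor_coef u F + taylor_coef v F.
Proof.
rewrite /taylor_coef; case: insubP => [F' _ _|_]; first by rewrite !ffunE.
by rewrite mulr0 addr0.
Qed.

Lemma taylor_coefD i (u v : taylor_module i) F :
  taylor_coef (u + v) F = taylor_coef u F + taylor_coef v F.
Proof. by have := taylor_coefP 1 u v F; rewrite scale1r mul1r. Qed.

Lemma taylor_coef0 i F : taylor_coef (0 : taylor_module i) F = 0.
Proof. by rewrite /taylor_coef; case: insubP => // F' _ _; rewrite ffunE. Qed.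

Lemma taylor_coefZ i (a : S) (u : taylor_module i) F :
  taylor_coef (a *: u) F = a * taylor_coef u F.
Proof. by have := taylor_coefP a u 0 F; rewrite !addr0 taylor_coef0 addr0. Qed.

Lemma taylor_coefB i (u v : taylor_module i) F :
  taylor_coef (u - v) F = taylor_coef u F - taylor_coef v F.
Proof. by rewrite -scaleN1r taylor_coefD taylor_coefZ mulN1r. Qed.

Lemma taylor_coef_sum i (J : finType) (Q : pred J) (w : J -> taylor_module i) F :
  taylor_coef (\sum_(j | Q j) w j) F = \sum_(j | Q j) taylor_coef (w j) F.
Proof.
apply: (big_morph (fun u : taylor_module i => taylor_coef u F)).
  by move=> u v; apply: taylor_coefD.
exact: taylor_coef0.
Qed.

Lemma taylor_ext i (u v : taylor_module i) :
  (forall F, taylor_coef u F = taylor_coef v F) -> u = v.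
Proof. by move=> uv; apply/ffunP => F; rewrite -!taylor_coef_val uv. Qed.

(* Multiplying the coefficient at [F] by the lcm of [F] turns the Taylor
   differential into the simplicial boundary. *)
Definition taylor_chain i (u : taylor_module i) F : S :=
  taylor_coef u F * 'X_[lcm_gen F].

Lemma taylor_chain_inj i (u v : taylor_module i) :
  (forall F, taylor_chain u F = taylor_chain v F) -> u = v.
Proof.
move=> uv; apply: taylor_ext => F; have := uv F; rewrite /taylor_chain.
apply: mulIf; rewrite -msupp_eq0 msuppX //.
Qed.

Lemma taylor_chain_supp i (u : taylor_module i) F m :
  (taylor_chain u F)@_m != 0 -> #|F| = i /\ (lcm_gen F <= m)%MM.
Proof.
rewrite /taylor_chain mcoeffMXE; case: ifP => [le|]; last by rewrite eqxx.
case: (eqVneq #|F| i) => [-> //|Fi].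
by rewrite taylor_coef_card // mcoeff0 eqxx.
Qed.

Lemma taylor_chain_exists i (U : {set 'I_k} -> S) :
  (forall F m, (U F)@_m != 0 -> #|F| = i /\ (lcm_gen F <= m)%MM) ->
  exists u : taylor_module i, forall F, taylor_chain u F = U F.
Proof.
move=> HU; have /boolp.choice [w wE] : forall F, exists p : S,
    forall m, p@_m = (U F)@_(m + lcm_gen F)%MM.
  move=> F; apply: (@mpoly_of_coeffs _ _ _ [seq (m - lcm_gen F)%MM | m <- msupp (U F)]).
  move=> m Um; apply/mapP; exists (m + lcm_gen F)%MM; rewrite ?addmK //.
  by rewrite mcoeff_msupp.
exists [ffun F : taylor_index i => w (val F) : S^o] => F; apply/mpolyP => m.
rewrite /taylor_chain mcoeffMXE /taylor_coef; case: insubP => [F' _ FE|Fi].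
  rewrite ffunE FE wE; case: ifP => [le|Nle]; first by rewrite submK.
  by apply/esym/eqP; apply: contraFT Nle => /HU [].
rewrite mcoeff0 if_same; apply/esym/eqP; apply: contraNT Fi => /HU [-> _].
exact: eqxx.
Qed.

Definition taylor_diff_fun i (u : taylor_module i.+1) : taylor_module i :=
  [ffun G : taylor_index i => \sum_(j | j \notin val G)
    (-1) ^+ inv_parity j (val G) *:
      ('X_[lcm_gen (j |: val G) - lcm_gen (val G)] * taylor_coef u (j |: val G))
    : S^o].

Lemma taylor_diff_linear i : linear (@taylor_diff_fun i).
Proof.
move=> a u v; apply/ffunP => G; rewrite !ffunE scaler_sumr -big_split /=.
apply: eq_bigr => j _; rewrite taylor_coefP mulrDr scalerDr; congr (_ + _).
by rewrite mulrCA scalerAr.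
Qed.

(* Locked, since unification otherwise unfolds the module structures. *)
Definition taylor_diff i : {linear taylor_module i.+1 -> taylor_module i} :=
  locked (mk_linear (@taylor_diff_linear i)).

Lemma taylor_diffE i (u : taylor_module i.+1) : taylor_diff i u = taylor_diff_fun u.
Proof. by rewrite /taylor_diff -lock. Qed.

Lemma taylor_diff_coef i (u : taylor_module i.+1) G : #|G| = i ->
  taylor_coef (taylor_diff i u) G = \sum_(j | j \notin G) (-1) ^+ inv_parity j G *:
      ('X_[lcm_gen (j |: G) - lcm_gen G] * taylor_coef u (j |: G)).
Proof.
move=> Gi; rewrite taylor_diffE {1}/taylor_coef;
case: insubP => [G' _ GE|]; last by rewrite Gi eqxx.
by rewrite ffunE GE.
Qed.

Lemma taylor_diff_chain i (u : taylor_module i.+1) G :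
  taylor_chain (taylor_diff i u) G = boundary (taylor_chain u) G.
Proof.
rewrite /boundary /taylor_chain; case: (eqVneq #|G| i) => [Gi|Gi].
  rewrite taylor_diff_coef // mulr_suml; apply: eq_bigr => j _.
  by rewrite -scalerAl mulrAC lcm_genK ?subsetUr // mulrC.
rewrite taylor_coef_card // mul0r big1 // => j jG.
by rewrite taylor_coef_card ?mul0r ?scaler0 // cardsU1 jG add1n eqSS.
Qed.

Lemma taylor_diff_diff i (u : taylor_module i.+2) :
  taylor_diff i (taylor_diff i.+1 u) = 0.
Proof.
apply: taylor_chain_inj => G; rewrite taylor_diff_chain.
rewrite {2}/taylor_chain taylor_coef0 mul0r -(boundary_boundary (taylor_chain u) G).
by apply: eq_bigr => j _; rewrite taylor_diff_chain.
Qed.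

Lemma mcoeff_boundary (U : {set 'I_k} -> S) G m :
  (boundary U G)@_m = boundary (fun F => (U F)@_m : K^o) G.
Proof. by rewrite raddf_sum; apply: eq_bigr => j _ /=; rewrite mcoeffZ. Qed.

(** In multidegree [m] the chain of [u] is a cycle of the full simplex on the generators dividing
    [m], which contracts to its [least] vertex. If no generator divides [m], the second hypothesis
    makes the chain vanish there. *)
Lemma taylor_exact i (u : taylor_module i) :
  (forall G, boundary (taylor_chain u) G = 0) ->
  (forall F m, (taylor_chain u F)@_m != 0 -> in_ideal g setT m) ->
  exists y, taylor_diff i y = u.
Proof.
move=> du uI; set U := taylor_chain u.
pose least m (v : 'I_k) := (g v <= m)%MM && [forall j, (g j <= m)%MM ==> (v <= j)%N].
pose h F m := if [pick v | least m v] is Some v then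
  if v \in F then (U (F :\ v))@_m else 0 else 0.
have /boolp.choice [C CE] F : exists p : S, forall m, p@_m = h F m.
  apply: (@mpoly_of_coeffs _ _ _ (flatten [seq msupp (U (F :\ v)) | v : 'I_k])) => m.
  rewrite /h; case: pickP => [v _|_]; last by rewrite eqxx.
  case: ifP => [vF Um|]; last by rewrite eqxx.
  by apply/flatten_mapP; exists v; rewrite ?mem_enum // mcoeff_msupp.
have [|y yE] := @taylor_chain_exists i.+1 C.
  move=> F m; rewrite CE /h; case: pickP => [v /andP [vm _]|_]; last by rewrite eqxx.
  case: ifP => [vF|]; last by rewrite eqxx.
  move/taylor_chain_supp => [Fi le]; rewrite (cardsD1 v F) vF Fi; split=> //.
  rewrite -(setD1K vF); apply/lcm_gen_le => a /setU1P [->//|].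
  exact: (lcm_gen_le _ _ le).
exists y; apply: taylor_chain_inj => G; rewrite taylor_diff_chain.
apply/mpolyP => m; rewrite mcoeff_boundary.
have -> : boundary (fun F => (taylor_chain y F)@_m : K^o) G =
    boundary (fun F => h F m : K^o) G by apply: eq_bigr => j _; rewrite yE CE.
case: (boolP [exists v, least m v]) => [/existsP [v lv]|/existsPn nolv].
  have hE F : h F m = if v \in F then (U (F :\ v))@_m else 0.
    rewrite /h; case: pickP => [w lw|/(_ v)]; last by rewrite lv.
    suff -> : w = v by [].
    move: lv lw => /andP [vm /forallP Hv] /andP [wm /forallP Hw].
    apply/val_inj/eqP; rewrite eqn_leq.
    by have := Hv w; have := Hw v; rewrite vm wm /= => -> ->.
  have -> : boundary (fun F => h F m : K^o) G =
      @boundary K k K^o (fun F => if v \in F then (U (F :\ v))@_m else 0) G.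
    by apply: eq_bigr => j _; rewrite hE.
  have /andP [vm /forallP vmin] := lv.
  apply: (@boundary_contraction _ _ _ (fun F => (U F)@_m : K^o)
    [set i | (g i <= m)%MM] v) => [|w|F|F].
  - by rewrite inE.
  - by rewrite inE => wm; have := vmin w; rewrite wm.
  - move=> /taylor_chain_supp [_ /lcm_gen_le le]; apply/subsetP => w /le.
    by rewrite inE.
  - by rewrite -mcoeff_boundary du mcoeff0.
have Um F : (U F)@_m = 0.
  apply/eqP; apply: contraT => /uI /in_idealP [w _ wm].
  case: (@arg_minnP _ w (fun v => (g v <= m)%MM) val wm) => v vm vmin.
  have /negP [] := nolv v; rewrite /least vm /=.
  by apply/forallP => j; apply/implyP; apply: vmin.
rewrite -/(U G) Um /boundary big1 // => j _; rewrite /h; case: pickP => [v lv|].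
  by have := nolv v; rewrite lv.
by rewrite scaler0.
Qed.

Lemma taylor_exactS i (u : taylor_module i.+1) :
  taylor_diff i u = 0 -> exists y, taylor_diff i.+1 y = u.
Proof.
move=> du; apply: taylor_exact => [G|F m].
  by rewrite -taylor_diff_chain du /taylor_chain taylor_coef0 mul0r.
move/taylor_chain_supp => [Fi /lcm_gen_le le].
have /card_gt0P [v vF] : (0 < #|F|)%N by rewrite Fi.
by apply/in_idealP; exists v; rewrite ?inE ?le.
Qed.

End Taylor.

(** * The Taylor complex resolves S/I *)

Section TaylorResolution.
Variables (K : fieldType) (n : nat) (I : idealr {mpoly K[n]}) (G : seq 'X_{1..n}).
Hypothesis genI : generates (fun m => m \in G) I.
Local Notation g := (generator (G := G)).

Lemma taylor_augmentation_linear :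
  linear (fun u : taylor_module K n (size G) 0 => quot_proj I (taylor_coef u set0)).
Proof. by move=> a u v; rewrite taylor_coefP quot_projD -quot_projM. Qed.

Lemma taylor_resolution :
  exact_seq (mk_linear taylor_augmentation_linear) (taylor_diff K g).
Proof.
split=> [y|u|i u].
- have c0 : #|set0 : {set 'I_(size G)}| == 0%N by rewrite cards0.
  exists [ffun _ => generic_quotient.repr y] => /=.
  by rewrite /taylor_coef insubT ffunE quot_proj_repr.
- have chain0 : taylor_chain g u set0 = taylor_coef u set0.
    rewrite /taylor_chain (_ : lcm_gen g set0 = 0%MM) ?mpolyX0 ?mulr1 //.
    by apply/mnmP => x; rewrite mnmE big_set0 mnm0E.
  rewrite /= quot_proj_eq0 (mem_monomial_ideal genI) -chain0; split=> [H|[y <-] m].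
    apply: taylor_exact => [F|F m Fm].
      rewrite /boundary big1 // => j jF.
      by rewrite /taylor_chain taylor_coef_card ?mul0r ?scaler0 // cardsU1 jF.
    have [/eqP] := taylor_chain_supp Fm; rewrite cards_eq0 => /eqP F0 _.
    by apply: H; rewrite mcoeff_msupp -F0.
  rewrite mcoeff_msupp taylor_diff_chain mcoeff_boundary => ym.
  have [j jm] : exists j, (taylor_chain g y (j |: set0))@_m != 0.
    apply/existsP; apply: contraNT ym => /existsPn H; rewrite /boundary big1 // => j _.
    by have := H j; rewrite negbK => /eqP ->; rewrite scaler0.
  have [_ /lcm_gen_le le] := taylor_chain_supp jm.
  by apply/in_idealP; exists j; rewrite ?inE // le // setU11.
- split=> [|[y <-]]; first exact: taylor_exactS.
  exact: taylor_diff_diff.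
Qed.

Lemma taylor_homotopy p : has_proj_resolution {ideal_quot I} p ->
  exists h : forall i, {linear taylor_module K n (size G) i ->
                               taylor_module K n (size G) i.+1},
    forall i x, (p <= i)%N ->
      x = taylor_diff K g i.+1 (h i.+1 x) + h i (taylor_diff K g i x).
Proof.
move=> resI; apply: (proj_dim_homotopy resI _ taylor_resolution) => i.
exact: projective_ffun.
Qed.

End TaylorResolution.

(** * Constant terms of the contracting homotopy *)

Section ConstantTerms.
Variables (K : fieldType) (n k : nat) (g : 'I_k -> 'X_{1..n}).
Local Notation T := (taylor_module K n k).
Local Notation d := (taylor_diff K g).
Implicit Types (F G : {set 'I_k}) (m : 'X_{1..n}).

(** Membership in the irrelevant maximal ideal times [T i], a submodule preserved by all linear
    maps. *)
Definition minimal_at i (u : T i) := forall F, (taylor_coef u F)@_0%MM = 0.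

Lemma minimal_at_linear i j (h : {linear T i -> T j}) u :
  minimal_at u -> minimal_at (h u).
Proof.
move=> u0 F; rewrite (ffun_delta_sum u) raddf_sum /= taylor_coef_sum.
rewrite raddf_sum big1 //= => F' _; rewrite linearZ /= taylor_coefZ.
by rewrite rmorphM /= -taylor_coef_val u0 mul0r.
Qed.

(** The monomial coefficient of the differential is 1, and so survives in the constant term, exactly
    when adding [j] does not change the lcm. *)
Lemma taylor_diff_const i (u : T i.+1) G : #|G| = i ->
  (taylor_coef (d i u) G)@_0%MM = \sum_(j | (j \notin G) && covered g G j)
    (-1) ^+ inv_parity j G * (taylor_coef u (j |: G))@_0%MM.
Proof.
move=> Gi; rewrite taylor_diff_coef // raddf_sum big_mkcondr /=.
apply: eq_bigr => j _; rewrite mcoeffZ rmorphM /= mcoeffX lcm_genU1_eq.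
by case: covered; rewrite ?mul1r ?mul0r ?mulr0.
Qed.

Definition taylor_basis i F : T i := [ffun F' => (val F' == F)%:R].

Lemma taylor_basis_coef i F F' : #|F| = i ->
  taylor_coef (taylor_basis i F) F' = (F' == F)%:R.
Proof.
move=> Fi; rewrite /taylor_coef; case: insubP => [F'' _ <-|]; first by rewrite ffunE.
by have [->|//] := eqVneq F' F; rewrite Fi eqxx.
Qed.

Lemma taylor_module_gt i (u : T i) : (k < i)%N -> u = 0.
Proof.
move=> ki; apply: taylor_ext => F; rewrite taylor_coef0 taylor_coef_card //.
apply/eqP => Fi; have := max_card (mem F); rewrite Fi card_ord.
by rewrite leqNgt ki.
Qed.

(** Were no generator covered, the top basis element [e] would have a differential without constant
    term. As nothing lies above [e], it equals [h] applied to that differential, against its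
    coefficient 1. *)
Lemma exactness_one_covered p
    (h : forall i, {linear T i -> T i.+1}) :
  (forall i x, (p <= i)%N -> x = d i.+1 (h i.+1 x) + h i (d i x)) ->
  (p < k)%N -> one_covered g setT.
Proof.
move=> hE pk; have k0 : (0 < k)%N by apply: leq_ltn_trans pk.
have [/existsP [i ci]|/existsPn N] := boolP [exists i, covered g (setT :\ i) i].
  by exists i.
pose e := taylor_basis k.-1.+1 setT.
have cT : #|[set: 'I_k]| = k.-1.+1 by rewrite cardsT card_ord prednK.
have pk1 : (p <= k.-1)%N by lia.
have := hE k.-1 e pk1; have kk : (k < k.-1.+2)%N by lia.
rewrite (@taylor_module_gt _ (h _ e) kk) raddf0 add0r => eE.
have de : minimal_at (d _ e).
  move=> G; have [Gk|Gk] := eqVneq #|G| k.-1; last by rewrite taylor_coef_card ?mcoeff0.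
  rewrite taylor_diff_const // big1 // => j /andP [jG cj].
  have [GE|GE] := eqVneq (j |: G) setT.
    by have := N j; rewrite -GE setU1K // cj.
  by rewrite taylor_basis_coef // (negbTE GE) mcoeff0 mulr0.
have := minimal_at_linear (h _) de setT; rewrite -eE taylor_basis_coef //.
by rewrite eqxx mcoeff1 eqxx => /eqP; rewrite oner_eq0.
Qed.

Lemma sub_covered F G i : F \subset G -> covered g F i -> covered g G i.
Proof.
move=> /subsetP FG /coveredP H; apply/coveredP => x; apply: leq_trans (H x) _.
by apply/bigmax_leqP => j /FG jG; rewrite (bigmax_sup j).
Qed.

Lemma covered_trans G a b : covered g (a |: G) b -> covered g G a -> covered g G b.
Proof.
move=> /coveredP Hb /coveredP Ha; apply/coveredP => x; apply: leq_trans (Hb x) _.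
by apply/bigmax_leqP => j /setU1P [->|jG]; [apply: Ha | rewrite (bigmax_sup j)].
Qed.

(** One degree below the top, the basis elements are the [setT :\ v]. An element there whose
    differential has no constant term agrees, in constant terms, with the differential of a top
    element; a failure of either graph condition produces one that does not. *)
Lemma exactness_two_covered p
    (h : forall i, {linear T i -> T i.+1}) :
  (forall i x, (p <= i)%N -> x = d i.+1 (h i.+1 x) + h i (d i x)) ->
  (p.+1 < k)%N -> two_covered g setT.
Proof.
move=> hE pk; have [i0 _ ci0] := exactness_one_covered hE (ltnW pk).
have kE : k = k.-2.+2 by lia.
have pk2 : (p <= k.-2)%N by lia.
pose V := [set v | covered g (setT :\ v) v].
have cD1 v : #|[set: 'I_k] :\ v| = k.-2.+1.
  by have := cardsD1 v [set: 'I_k]; rewrite inE cardsT card_ord; lia.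
have missing G j : #|G| = k.-2 -> j \notin G -> exists b,
    [/\ b \notin G, b != j, j |: G = setT :\ b & G = setT :\ j :\ b].
  move=> Gk jG; have : (0 < #|~: G :\ j|)%N.
    have := cardsD1 j (~: G); have := cardsC G; rewrite inE jG card_ord; lia.
  case/card_gt0P => b; rewrite !inE => /andP [bj bG]; exists b.
  have GE : G = setT :\ j :\ b.
    apply/eqP; rewrite eqEcard; apply/andP; split.
      apply/subsetP => a aG; rewrite !inE andbT.
      by apply/andP; split; apply: contraTneq aG => ->.
    by have := cardsD1 b (setT :\ j); rewrite cD1 !inE bj; lia.
  split=> //; rewrite GE; apply/setP => a; rewrite !inE andbT.
  by case: (eqVneq a j) => [->|] //=; rewrite ?andbT ?orbF // eq_sym.
exists V; split=> //.
- by apply/set0Pn; exists i0; rewrite inE.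
- by move=> v; rewrite inE.
- apply/cut_connectedP => P PV P0 PnV; apply: boolp.contrapT => Ncross.
  have cross a b : a \in P -> b \in V -> b \notin P -> edge g setT a b -> False.
    by move=> aP bV bP eab; apply: Ncross; exists a, b.
  (* [z] is the signed sum of the [setT :\ v] for [v] in [P]; each index set misses one element, so
     each inner sum has at most one term. *)
  pose z : T k.-2.+1 := [ffun F : taylor_index k k.-2.+1 => \sum_(v | (v \notin val F) && (v \in P))
    (-1) ^+ inv_parity v (val F) : {mpoly K[n]}^o].
  have zE v : taylor_coef z (setT :\ v) = if v \in P then
      (-1) ^+ inv_parity v (setT :\ v) else 0.
    rewrite /taylor_coef insubT ?cD1 // => Hv; rewrite ffunE /=.
    case: ifP => vP; last first.
      by rewrite big_pred0 // => a; rewrite !inE andbT negbK; case: eqP => [->|].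
    rewrite (big_pred1 v) // => a; rewrite !inE andbT negbK.
    by case: eqP => [->|].
  have dz : minimal_at (d _ z).
    move=> G; have [Gk|Gk] := eqVneq #|G| k.-2; last by rewrite taylor_coef_card ?mcoeff0.
    have [a aG] : exists a, a \notin G.
      have : (0 < #|~: G|)%N by have := cardsC G; rewrite card_ord; lia.
      by case/card_gt0P => a; rewrite inE; exists a.
    have [b [bG ba aGE GE]] := missing G a Gk aG.
    have bGE : b |: G = setT :\ a by rewrite GE setD1K // !inE ba.
    (* A surviving constant term would create an edge, which cannot leave [P]; so the two terms at
       [G] survive together, and they cancel. *)
    have key x y : x \notin G -> x |: G = setT :\ y -> G = setT :\ x :\ y ->
        covered g G x -> y \in P -> x \in P /\ covered g G y.
      move=> xG xE xyE cx yP; have cy : covered g G y.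
        apply: covered_trans cx; rewrite xE.
        by have := subsetP PV y yP; rewrite inE.
      split=> //; apply: boolp.contrapT => /negP xP; apply: (cross y x) => //.
        by rewrite inE; apply: sub_covered cx; rewrite subsetD1 subsetT.
      by rewrite edge_sym /edge -xyE cx.
    have GE' : G = setT :\ b :\ a by rewrite setD1C.
    rewrite taylor_diff_const // big_mkcondr /=.
    rewrite (bigD1 a) //= (bigD1 b) ?bG //= big1 ?addr0; last first.
      move=> j /andP [/andP [jG ja] jb]; move: jG.
      by rewrite GE !inE jb ja.
    rewrite aGE bGE !zE.
    have signs : (-1) ^+ inv_parity b (setT :\ b) = (-1) ^+ inv_parity b G *
       (-1) ^+ (a < b)%N :> {mpoly K[n]} by rewrite -aGE inv_parityU1 // signr_addb.
    have signs' : (-1) ^+ inv_parity a (setT :\ a) = (-1) ^+ inv_parity a G *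
       (-1) ^+ (b < a)%N :> {mpoly K[n]} by rewrite -bGE inv_parityU1 // signr_addb.
    have mc0 (c : bool) : ((-1) ^+ c : {mpoly K[n]})@_0%MM = (-1) ^+ c.
      by rewrite rmorphXn rmorphN rmorph1.
    have [/andP [ca bP]|Nab] := boolP (covered g G a && (b \in P)).
      have [aP cb] := key a b aG aGE GE ca bP.
      rewrite ca cb aP bP signs signs' !rmorphM /= !mc0 [X in _ + X]mulrCA.
      rewrite -mulrDr -mulrDr; case: (ltngtP a b) => [||/val_inj ab].
      - by rewrite expr1 expr0 addNr !mulr0.
      - by rewrite expr1 expr0 addrN !mulr0.
      - by rewrite ab eqxx in ba.
    have Nba : ~~ (covered g G b && (a \in P)).
      by apply: contra Nab => /andP [cb aP]; have [-> ->] := key b a bG bGE GE' cb aP.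
    move: Nab Nba; rewrite !negb_and.
    by case: (covered g G a) => /= [/negbTE ->|_]; case: (covered g G b) => /= [/negbTE ->|_];
      rewrite ?mcoeff0 ?mulr0 ?addr0.
  have zhz : z = d k.-2.+1 (h k.-2.+1 z) + h k.-2 (d k.-2 z) by apply: hE.
  pose w := (taylor_coef (h k.-2.+1 z) setT)@_0%MM.
  (* The differential of a top element has the same constant term, up to sign, at every [v] of [V],
     whereas [z] is nonzero exactly on [P]. *)
  have wE v : v \in V -> (taylor_coef z (setT :\ v))@_0%MM =
      (-1) ^+ inv_parity v (setT :\ v) * w.
    move=> vV; rewrite {1}zhz taylor_coefD mcoeffD.
    rewrite (minimal_at_linear _ dz) addr0 taylor_diff_const ?cD1 //.
    rewrite (big_pred1 v) => [|a]; first by rewrite setD1K ?inE.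
    rewrite !inE andbT negbK; case: eqP => // ->.
    by move: vV; rewrite inE.
  case/set0Pn: P0 => a aP; have aV := subsetP PV a aP.
  have /properP [_ [b bV bP]] : P \proper V by rewrite properEneq PnV.
  have := wE b bV; rewrite zE (negbTE bP) mcoeff0 => /esym/eqP.
  rewrite mulf_eq0 signr_eq0 /= => /eqP w0; have := wE a aV; rewrite zE aP w0 mulr0.
  rewrite -signr_odd => /eqP; case: odd => /=.
    by rewrite expr1 mcoeffN mcoeff1 eqxx oppr_eq0 oner_eq0.
  by rewrite expr0 mcoeff1 eqxx oner_eq0.
- move=> v; rewrite !inE andbT => Nv.
  pose x := taylor_basis k.-2.+1 (setT :\ v).
  have xE : x = d k.-2.+1 (h k.-2.+1 x) + h k.-2 (d k.-2 x) by apply: hE.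
  have [/existsP [i ci]|/existsPn N] :=
      boolP [exists i, (i != v) && covered g (setT :\ v :\ i) i].
    case/andP: ci => iv ci; exists i; last by [].
    by rewrite inE; apply: sub_covered ci; rewrite setD1C subsetDl.
  have dx : minimal_at (d _ x).
    move=> G; have [Gk|Gk] := eqVneq #|G| k.-2; last by rewrite taylor_coef_card ?mcoeff0.
    rewrite taylor_diff_const // big1 // => j /andP [jG cj].
    rewrite taylor_basis_coef ?cD1 //; have [jGE|jGE] := eqVneq; last by rewrite mcoeff0 mulr0.
    have jv : j != v by have := setU11 j G; rewrite jGE !inE => /andP [].
    by have := N j; rewrite jv -jGE setU1K // cj.
  have := congr1 (fun y => (taylor_coef y (setT :\ v))@_0%MM) xE.
  rewrite taylor_coefD mcoeffD (minimal_at_linear _ dx) addr0.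
  rewrite taylor_basis_coef ?cD1 // eqxx mcoeff1 eqxx taylor_diff_const ?cD1 //.
  rewrite big1 => [/eqP|j]; first by rewrite oner_eq0.
  rewrite !inE andbT negbK => /andP [/eqP -> cv].
  by rewrite cv in Nv.
Qed.

End ConstantTerms.

(** * First syzygies and projective dimension at most one *)

Section LowDimension.
Variables (K : fieldType) (n k : nat) (g : 'I_k -> 'X_{1..n}).
Local Notation S := {mpoly K[n]}.
Local Notation T := (taylor_module K n k).
Local Notation d := (taylor_diff K g).
Implicit Types (F G C P : {set 'I_k}) (m : 'X_{1..n}).

(* The image of [d p] is projective when the projective dimension is at most
   [p.+1]: [s] is the composite of [d p] with a section. *)
Lemma syzygy_section p (h : forall i, {linear T i -> T i.+1}) :
  (forall i x, (p.+1 <= i)%N -> x = d i.+1 (h i.+1 x) + h i (d i x)) ->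
  exists s : {linear T p.+1 -> T p.+1},
    (forall u, d p (s u) = d p u) /\ forall u, s (d p.+1 u) = 0.
Proof.
move=> hE; pose s : {linear T p.+1 -> T p.+1} := idfun \- (d p.+1 \o h p.+1).
have sE u : s u = u - d p.+1 (h p.+1 u) by [].
exists s; split=> u; rewrite sE; first by rewrite raddfB /= taylor_diff_diff subr0.
apply/eqP; rewrite subr_eq0; apply/eqP.
have {1}-> := hE p.+1 u (leqnn _).
by rewrite raddfD /= taylor_diff_diff add0r.
Qed.

Definition vertex i : T 1 := taylor_basis K n 1 [set i].

Lemma vertex_coef i F : taylor_coef (vertex i) F = (F == [set i])%:R.
Proof. by rewrite taylor_basis_coef ?cards1. Qed.

Lemma set2_eq (a l i j : 'I_k) : i != j -> l != a ->
  (l |: [set a] == [set i; j]) = (l == i) && (a == j) || (l == j) && (a == i).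
Proof.
move=> ij la; apply/eqP/orP => [E|[/andP [/eqP -> /eqP ->]|/andP [/eqP -> /eqP ->]]] //.
  have : a \in [set i; j] by rewrite -E !inE eqxx orbT.
  have : l \in [set i; j] by rewrite -E setU11.
  rewrite !inE; case: (eqVneq l i) => [li _|_ /eqP lj]; rewrite ?lj ?li in la *.
    by rewrite (eq_sym a i) (negbTE la) /= => ->; left.
  by rewrite (eq_sym a j) (negbTE la) orbF eqxx => ->; right.
by rewrite setUC.
Qed.

Lemma lcm_gen1 i : lcm_gen g [set i] = g i.
Proof. by apply/mnmP => x; rewrite mnmE big_set1. Qed.

Lemma inv_parity1 (i j : 'I_k) : inv_parity j [set i] = (i < j)%N.
Proof.
rewrite -[ [set i] ]setU0 inv_parityU1 ?inE // /inv_parity (_ : [set _ in _ | _] = set0).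
  by rewrite cards0.
by apply/setP => a; rewrite !inE.
Qed.

Lemma linear_relation (R : nzRingType) (U V : lmodType R) (f : {linear U -> V})
    (e : bool) a b x u v :
  x = (-1) ^+ e *: (a *: u - b *: v) -> f x = 0 -> a *: f u = b *: f v.
Proof.
move=> ->; rewrite linearZ_LR linearB !linearZ_LR scaler_sign => H; apply/subr0_eq.
by rewrite scalerN in H; case: e H => //= H; apply: oppr_inj; rewrite oppr0.
Qed.

Lemma taylor_coef_relation i (a b : S) (u v : T i) F :
  a *: u = b *: v -> a * taylor_coef u F = b * taylor_coef v F.
Proof. by rewrite -!taylor_coefZ => ->. Qed.

Lemma taylor_coef_lin2 i (a b c : S) (u v : T i) F :
  taylor_coef (c *: (a *: u - b *: v)) F =
  c * (a * taylor_coef u F - b * taylor_coef v F).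
Proof. by rewrite taylor_coefZ taylor_coefB !taylor_coefZ. Qed.

Lemma taylor_diff_edge i j : i != j ->
  d 1 (taylor_basis K n 2 [set i; j]) = (-1) ^+ (i < j)%N *:
    ('X_[lcm_gen g [set i; j] - g i] *: vertex i -
     'X_[lcm_gen g [set i; j] - g j] *: vertex j).
Proof.
move=> ij; apply: taylor_ext => F; have [/eqP/cards1P [a ->]|F1] := eqVneq #|F| 1%N; last first.
  by rewrite !taylor_coef_card.
have cij : #|[set i; j]| = 2 by rewrite cards2 ij.
rewrite [RHS]taylor_coef_lin2 (vertex_coef i) (vertex_coef j) [LHS]taylor_diff_coef ?cards1 //.
rewrite !(inj_eq set1_inj).
have termE l : l \notin [set a] -> taylor_coef (taylor_basis K n 2 [set i; j]) (l |: [set a])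
    = ((l == i) && (a == j) || (l == j) && (a == i))%:R.
  by rewrite inE => la; rewrite taylor_basis_coef // set2_eq.
have [ai|ai] := eqVneq a i.
  rewrite (bigD1 j) /=; last by rewrite inE ai eq_sym.
  rewrite big1 ?addr0 => [|l /andP [la lj]]; last first.
    rewrite termE // (negbTE lj) ai (negbTE ij) andbF /=.
    by rewrite mulr0 scaler0.
  rewrite termE ?inE ?ai ?(eq_sym j) ?eqxx ?orbT // (negbTE ij) mulr0 subr0.
  rewrite inv_parity1 lcm_gen1 setUC !mulr1.
  by rewrite mulr_sign scaler_sign.
have [aj|aj] := eqVneq a j.
  rewrite (bigD1 i) /=; last by rewrite inE aj.
  rewrite big1 ?addr0 => [|l /andP [la li]]; last first.
    by rewrite termE // (negbTE li) (negbTE ai) andbF /= mulr0 scaler0.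
  rewrite termE ?inE ?aj ?eqxx // mulr0 sub0r.
  rewrite inv_parity1 lcm_gen1 !mulr1 mulr_sign scaler_sign.
  case: (ltngtP i j) => [||/val_inj eij]; rewrite ?opprK //.
  by rewrite eij eqxx in ij.
rewrite !mulr0 subr0 mulr0 big1 // => l la.
by rewrite termE // (negbTE aj) (negbTE ai) !andbF mulr0 scaler0.
Qed.

Lemma taylor_diff0 (u : T 1) :
  taylor_coef (d 0 u) set0 = \sum_j 'X_[g j] * taylor_coef u [set j].
Proof.
rewrite taylor_diff_coef ?cards0 //; apply: eq_big => j; first by rewrite inE.
move=> _; rewrite setU0 lcm_gen1 (_ : lcm_gen g set0 = 0%MM) ?subm0.
  rewrite /inv_parity (_ : [set _ in _ | _] = set0) ?cards0 ?scale1r //.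
  by apply/setP => a; rewrite !inE.
by apply/mnmP => x; rewrite mnmE big_set0 mnm0E.
Qed.

(** The section [s] respects the relations between pairs of generators. A nonzero constant term on
    the diagonal of [s] at [i] then forces [g i] to divide every generator. *)
Lemma exactness_principal (h : forall i, {linear T i -> T i.+1}) (l : 'I_k) :
  (forall i x, (1 <= i)%N -> x = d i.+1 (h i.+1 x) + h i (d i x)) ->
  exists i, forall j, (g i <= g j)%MM.
Proof.
move=> /syzygy_section [s [ds sd]].
have rel i j : 'X_[lcm_gen g [set i; j] - g i] *: s (vertex i) =
    'X_[lcm_gen g [set i; j] - g j] *: s (vertex j).
  have [->//|ij] := eqVneq i j.
  exact: linear_relation (taylor_diff_edge ij) (sd _).
have lcm2 x i j : lcm_gen g [set i; j] x = maxn (g i x) (g j x).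
  rewrite mnmE; have [->|ij] := eqVneq i j; first by rewrite setUid big_set1 maxnn.
  by rewrite big_setU1 ?inE //= big_set1.
(* The image of [s (vertex l)] is the monomial of [g l], so some summand contains that monomial. *)
have [i im] : exists i, ('X_[g i] * taylor_coef (s (vertex l)) [set i])@_(g l) != 0.
  apply/existsP; apply: contraT => /existsPn N.
  have := taylor_diff0 (s (vertex l)); rewrite ds taylor_diff0 (bigD1 l) //=.
  rewrite vertex_coef eqxx mulr1 big1 ?addr0 => [|j jl]; last first.
    by rewrite vertex_coef (inj_eq set1_inj) (negbTE jl) mulr0.
  move/(congr1 (mcoeff (g l))); rewrite mcoeffX eqxx raddf_sum /= big1 => [/eqP|j _].
    by rewrite oner_eq0.
  by apply/eqP; have := N j; rewrite negbK.
move: im; rewrite mulrC mcoeffMXE; case: ifP => [il im|]; last by rewrite eqxx.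
have lcmil : lcm_gen g [set i; l] = g l.
  by apply/mnmP => x; rewrite lcm2; apply/maxn_idPr; move/mnm_lepP: il.
have ii : (taylor_coef (s (vertex i)) [set i])@_0%MM != 0.
  have := taylor_coef_relation [set i] (rel i l).
  rewrite lcmil (_ : (g l - g l)%MM = 0%MM) ?mpolyX0 ?mul1r; last first.
    by apply/mnmP => x; rewrite mnmBE subnn mnm0E.
  move/(congr1 (mcoeff (g l - g i)%MM)); rewrite mulrC mcoeffMXE lepm_refl => E.
  rewrite -E in im; apply: contraNneq im => i0; rewrite (_ : (_ - _)%MM = 0%MM) ?i0 //.
  by apply/mnmP => x; rewrite mnmBE subnn mnm0E.
(* The left side contains lcm/g_i, the right side is a multiple of lcm/g_j; hence g_i divides
   g_j. *)
exists i => j; have := taylor_coef_relation [set i] (rel i j).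
move/(congr1 (mcoeff (lcm_gen g [set i; j] - g i)%MM)).
rewrite mulrC mcoeffMXE lepm_refl ['X_[_ - g j] * _]mulrC mcoeffMXE.
rewrite (_ : (_ - _ - (_ - _))%MM = 0%MM); last first.
  by apply/mnmP => x; rewrite mnmBE subnn mnm0E.
case: ifP => [/mnm_lepP le _|_ i0]; last by rewrite i0 eqxx in ii.
by apply/mnm_lepP => x; have := le x; rewrite !mnmBE lcm2; lia.
Qed.

End LowDimension.

(** * The syzygy tree *)

Lemma triangle_sum (V : zmodType) (u v w : V) : (u - v) + (- (w - v) + (w - u)) = 0.
Proof. by rewrite opprB subrKA addrC subrKA subrr. Qed.

Definition ffun_lift (R : nzRingType) (I : finType) (V : lmodType R) (m : I -> V) :=
  mk_linear (ffun_lift_linear m).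

Lemma ffun_lift_comp (R : nzRingType) (I : finType) (V W : lmodType R) (m : I -> V)
    (f : {linear V -> W}) (D : {linear {ffun I -> R^o} -> W}) :
  (forall i, f (m i) = D (ffun_delta R i)) -> forall u, f (ffun_lift m u) = D u.
Proof.
move=> fm u; rewrite [in RHS](ffun_delta_sum u).
have -> : ffun_lift m u = \sum_i (u i : R) *: m i by [].
by rewrite !linear_sum; apply: eq_bigr => i _; rewrite !linearZ_LR fm.
Qed.

Section SyzygyTree.
Variables (K : fieldType) (n k : nat) (g : 'I_k -> 'X_{1..n}).
Local Notation S := {mpoly K[n]}.
Local Notation T := (taylor_module K n k).
Local Notation d := (taylor_diff K g).
Implicit Types (F C P : {set 'I_k}) (m : 'X_{1..n}) (E : {set {set 'I_k}}).

Definition adjacent E : rel 'I_k := fun i j => (i != j) && ([set i; j] \in E).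

Lemma adjacent_sym E : symmetric (adjacent E).
Proof. by move=> i j; rewrite /adjacent eq_sym setUC. Qed.

Definition supported_on E (r : T 2) := forall F, F \notin E -> taylor_coef r F = 0.

Lemma supported_onP E a r r' :
  supported_on E r -> supported_on E r' -> supported_on E (a *: r + r').
Proof. by move=> Er Er' F FE; rewrite taylor_coefP Er // Er' // mulr0 addr0. Qed.

Lemma supported_on0 E : supported_on E 0.
Proof. by move=> F _; rewrite taylor_coef0. Qed.

Lemma sign_scaler_lin2 (R : comNzRingType) (V : lmodType R) (e : bool) (x a b : R)
    (u v : V) :
  (- (-1) ^+ e * x) *: ((-1) ^+ e *: (a *: u - b *: v)) =
  (x * b) *: v - (x * a) *: u.
Proof.
rewrite scalerA mulrAC mulNr -expr2 sqrr_sign mulN1r scalerBr !scalerA !mulNr.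
by rewrite !scaleNr opprK addrC.
Qed.

(** The factor is m/lcm with a sign that orients the edge from [i] to [j], so that consecutive edges
    telescope. *)
Lemma edge_bridge i j m : i != j -> (lcm_gen g [set i; j] <= m)%MM ->
  exists2 a : S, a != 0 & d 1 (a *: taylor_basis K n 2 [set i; j]) =
    'X_[m - g j] *: vertex K n j - 'X_[m - g i] *: vertex K n i.
Proof.
move=> ij le; set L := lcm_gen g [set i; j] in le *.
exists (- (-1) ^+ (i < j)%N * 'X_[m - L]).
  by rewrite mulf_neq0 ?oppr_eq0 ?signr_eq0 // -msupp_eq0 msuppX.
have XE v : v \in [set i; j] -> 'X_[m - L] * 'X_[L - g v] = 'X_[m - g v] :> S.
  move=> vij; rewrite -mpolyXD; congr 'X_[_]; apply/mnmP => x.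
  have := mnm_lepP le x; have := mnm_lepP (le_lcm_gen g vij) x.
  rewrite mnmDE !mnmBE -/L; lia.
rewrite linearZ_LR taylor_diff_edge // -/L sign_scaler_lin2.
by rewrite (XE _ (set22 i j)) (XE _ (set21 i j)).
Qed.

(** Telescoping along a path without choosing one: the set [R] of vertices reached admits no cut,
    because a crossing edge extends it. *)
Lemma path_syzygy E C m i j : cut_connected (adjacent E) C ->
  {in C, forall v, (g v <= m)%MM} -> i \in C -> j \in C ->
  exists r, [/\ supported_on E r,
    forall F, ~~ (F \subset C) -> taylor_coef r F = 0 &
    d 1 r = 'X_[m - g j] *: vertex K n j - 'X_[m - g i] *: vertex K n i].
Proof.
move=> /cut_connectedP connC Cm iC.
pose good j := exists r, [/\ supported_on E r,
  forall F, ~~ (F \subset C) -> taylor_coef r F = 0 &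
  d 1 r = 'X_[m - g j] *: vertex K n j - 'X_[m - g i] *: vertex K n i].
pose R := [set j in C | boolp.asbool (good j)].
suff CR : C = R.
  by move=> jC; move: (jC); rewrite {1}CR inE => /andP [_ /boolp.asboolP].
apply/esym/eqP; apply: contraT => RC.
have iR : i \in R.
  rewrite inE iC; apply/boolp.asboolP; exists 0; split; first exact: supported_on0.
    by move=> F _; rewrite taylor_coef0.
  by rewrite raddf0 subrr.
have [||a [b [aR bC bR /andP [ab abE]]]] := connC R _ _ RC.
- by apply/subsetP => u; rewrite inE => /andP [].
- by apply/set0Pn; exists i.
move: aR; rewrite inE => /andP [aC /boolp.asboolP [r [rE rC dr]]].
have abC : [set a; b] \subset C by apply/subsetP => u; rewrite !inE => /orP [] /eqP ->.
have le : (lcm_gen g [set a; b] <= m)%MM.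
  by apply/lcm_gen_le => v /(subsetP abC); apply: Cm.
have [c _ dc] := edge_bridge ab le.
have ce F : F != [set a; b] -> taylor_coef (taylor_basis K n 2 [set a; b]) F = 0.
  by move=> /negbTE Fab; rewrite taylor_basis_coef ?cards2 ?ab // Fab.
suff bR' : b \in R by rewrite bR' in bR.
rewrite inE bC; apply/boolp.asboolP.
exists (c *: taylor_basis K n 2 [set a; b] + r); split.
- apply: supported_onP rE => F FE; apply: ce.
  by apply: contraNneq FE => ->.
- move=> F FC; rewrite taylor_coefP rC // ce ?mulr0 ?addr0 //.
  by apply: contraNneq FC => ->.
- exact: etrans (linearD _ _ _) (etrans (congr2 +%R dc dr) (subrKA _ _ _)).
Qed.

Lemma taylor_basis_delta i (F : taylor_index k i) :
  taylor_basis K n i (val F) = ffun_delta S F.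
Proof. by apply/ffunP => F'; rewrite !ffunE. Qed.

Lemma taylor_coef_linear i j (f : {linear T i -> T j}) (u : T i) F :
  taylor_coef (f u) F = \sum_F' u F' * taylor_coef (f (ffun_delta S F')) F.
Proof.
rewrite {1}(ffun_delta_sum u) linear_sum taylor_coef_sum; apply: eq_bigr => F' _.
by rewrite linearZ_LR taylor_coefZ.
Qed.

Lemma taylor_coef_lin3 i (a b : S) (u v w : T i) F :
  taylor_coef (a *: u + (b *: v + w)) F =
  a * taylor_coef u F + (b * taylor_coef v F + taylor_coef w F).
Proof. by rewrite !taylor_coefP. Qed.

Lemma mcoeffM_low (p q : S) D m : (forall m', (mdeg m' < D)%N -> p@_m' = 0) ->
  q@_0%MM = 0 -> (mdeg m < D.+1)%N -> (p * q)@_m = 0.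
Proof.
move=> pD q0 mD; apply: memN_msupp_eq0; apply/negP => /msuppM_le /allpairsP [[m1 m2]] /=.
case; rewrite !mcoeff_msupp => p1 q2 mE.
have m20 : m2 != 0%MM by apply: contraNneq q2 => ->; rewrite q0.
case/negP: p1; apply/eqP/pD; move: mD; rewrite mE mdegD.
by have : (0 < mdeg m2)%N by [rewrite lt0n mdeg_eq0]; lia.
Qed.

(* Sum the coefficients of [d 1 r] over one side of a cut crossed by [f]
   alone. *)
Lemma cut_syzygy_const E (f : {set 'I_k}) m P r (a0 b0 : 'I_k) :
  supported_on E r -> d 1 r = 0 ->
  P \subset gen_divisors g m -> a0 \in P -> b0 \in gen_divisors g m :\: P ->
  f = [set a0; b0] ->
  (forall a b, a \in P -> b \in gen_divisors g m :\: P -> adjacent E a b ->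
     [set a; b] = f) ->
  (taylor_coef r f)@_0%MM = 0.
Proof.
move=> rE dr PX a0P; rewrite inE => /andP [b0P b0X] fE only.
have a0X := subsetP PX a0 a0P.
have lef : (lcm_gen g f <= m)%MM.
  by rewrite fE; apply/lcm_gen_le => v; rewrite !inE => /orP [] /eqP ->;
    [move: a0X | move: b0X]; rewrite inE.
pose A (a b : 'I_k) : K := ((-1) ^+ (a < b)%N *: taylor_chain g r [set a; b])@_(lcm_gen g f).
have rowE a : \sum_(b | b != a) A a b = 0.
  have := taylor_diff_chain g r [set a]; rewrite dr /taylor_chain taylor_coef0 mul0r.
  move/(congr1 (mcoeff (lcm_gen g f))); rewrite mcoeff0 => E0.
  rewrite [RHS]E0 raddf_sum /=; apply: eq_big => [b|b ba]; first by rewrite inE.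
  by rewrite /A inv_parity1 setUC.
have : \sum_(a in P) \sum_(b | b != a) A a b = 0 by rewrite big1 // => a _.
have ab0 : a0 != b0 by apply: contraNneq b0P => <-.
have split_in a : \sum_(b | b != a) A a b =
    \sum_(b | (b != a) && (b \in P)) A a b + \sum_(b | (b != a) && (b \notin P)) A a b.
  by rewrite (bigID (mem P)).
rewrite (eq_bigr _ (fun a _ => split_in a)) big_split /=.
(* Edges inside [P] are counted from both ends with opposite signs. *)
have -> : \sum_(a in P) \sum_(b | (b != a) && (b \in P)) A a b = 0.
  rewrite big_mkcond /=.
  rewrite (eq_bigr (fun a => \sum_(b | [&& a \in P, b \in P & b != a]) A a b)).
    apply: sum_antisym => [a b|a|a b /and3P [_ _ ba]].
    - by rewrite andbCA eq_sym.
    - by rewrite eqxx !andbF.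
    - rewrite /A setUC !scaler_sign; case: (ltngtP a b) => [||/val_inj eab] /=.
      + by rewrite mcoeffN.
      + by rewrite mcoeffN opprK.
      + by rewrite eab eqxx in ba.
  move=> a _; case: (a \in P); last by rewrite big_pred0.
  by apply: eq_bigl => b; rewrite andbC.
rewrite add0r.
have A0 a b : a \in P -> b \notin P -> A a b != 0 -> a = a0 /\ b = b0.
  move=> aP bP; rewrite /A mcoeffZ mulf_eq0 negb_or => /andP [_ Aab].
  have [_ /lcm_gen_le le] := taylor_chain_supp Aab.
  have bX : b \in gen_divisors g m.
    by rewrite inE; apply: lepm_trans lef; apply: le; rewrite !inE eqxx orbT.
  have ab : a != b by apply: contraNneq bP => <-.
  have abE : [set a; b] \in E.
    apply: contraNT Aab => NE; rewrite /taylor_chain rE // mul0r mcoeff0.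
    exact: eqxx.
  have abf : [set a; b] = [set a0; b0].
    by rewrite -fE; apply: only => //; [rewrite in_setD bP | rewrite /adjacent ab].
  have : a \in [set a0; b0] by rewrite -abf set21.
  have : b \in [set a0; b0] by rewrite -abf set22.
  rewrite !inE => /orP [/eqP bE|/eqP ->]; first by rewrite bE a0P in bP.
  by case/orP => /eqP aE //; rewrite aE (negbTE b0P) in aP.
rewrite (bigD1 a0) //= (bigD1 b0) /=; last by rewrite eq_sym ab0 b0P.
rewrite big1 ?addr0 => [|b /andP [/andP [ba bP] bb]]; last first.
  by apply/eqP; apply: contraNT bb => /(A0 _ _ a0P bP) [_ ->].
rewrite big1 ?addr0 => [|a /andP [aP aa]]; last first.
  rewrite big1 // => b /andP [ba bP].
  by apply/eqP; apply: contraNT aa => /(A0 _ _ aP bP) [->].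
move/eqP; rewrite /A mcoeffZ mulf_eq0 signr_eq0 /= -fE /taylor_chain.
rewrite mcoeffMXE lepm_refl => /eqP <-; congr (_@__).
by apply/mnmP => x; rewrite mnmBE subnn mnm0E.
Qed.

Lemma exactness_tree (h : forall i, {linear T i -> T i.+1}) :
  (forall i x, (2 <= i)%N -> x = d i.+1 (h i.+1 x) + h i (d i x)) ->
  exists e : rel 'I_k, [/\ symmetric e,
    forall C v u w, cut_connected e C -> v \notin C -> u \in C -> w \in C ->
      e v u -> e v w -> u = w,
    cut_connected e setT & forall m, cut_connected e (gen_divisors g m)].
Proof.
move=> /syzygy_section [s [ds sd]].
pose connecting E := boolp.asbool (forall m, cut_connected (adjacent E) (gen_divisors g m)).
have connT : connecting setT.
  apply/boolp.asboolP => m; apply/cut_connectedP => P PX P0 PnX.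
  have /properP [_ [b bX bP]] : P \proper gen_divisors g m by rewrite properEneq PnX.
  case/set0Pn: P0 => a aP; exists a, b; split=> //.
  by rewrite /adjacent inE andbT; apply: contraNneq bP => <-.
have [E minE _] := @minset_exists _ connecting setT connT.
have /boolp.asboolP connE := minsetp minE.
exists (adjacent E).
have allm : gen_divisors g (lcm_gen g setT) = setT.
  by apply/setP => v; rewrite !inE le_lcm_gen ?inE.
(* By minimality of [E], deleting [F] disconnects the divisors of some [m], along a cut that only
   [F] crosses. *)
have minimal r F : supported_on E r -> d 1 r = 0 -> (taylor_coef r F)@_0%MM = 0.
  move=> rE dr; have [FE|FE] := boolP (F \in E); last by rewrite rE ?mcoeff0.
  have NC : ~ forall m, cut_connected (adjacent (E :\ F)) (gen_divisors g m).
    move=> /boolp.asboolP cEF; have := minsetinf minE cEF (subsetDl _ _) => EFE.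
    by have := FE; rewrite -EFE setD11.
  have [m Nm] : exists m, ~~ cut_connected (adjacent (E :\ F)) (gen_divisors g m).
    apply: boolp.contrapT => N; apply: NC => m; apply: contraT => Nm.
    by case: N; exists m.
  case/forallPn: Nm => P; rewrite negb_imply => /andP [/and3P [PX P0 PnX]].
  move/exists_inPn => NP.
  have [a [b [aP bX bP adj]]] := cut_connectedP _ _ (connE m) P PX P0 PnX.
  have only a' b' : a' \in P -> b' \in gen_divisors g m :\: P ->
      adjacent E a' b' -> [set a'; b'] = F.
    move=> a'P b'X /andP [ab' abE']; have := NP a' a'P; rewrite negb_exists_in.
    move/forall_inP => /(_ b' b'X); rewrite /adjacent ab' !inE abE' andbT /= negbK.
    by move/eqP.
  have bXP : b \in gen_divisors g m :\: P by rewrite inE bP.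
  apply: (@cut_syzygy_const E F m P r a b) => //.
  by rewrite (only a b).
have lift (p : 'I_k * 'I_k) : exists r : T 2, p.1 != p.2 ->
    supported_on E r /\ d 1 r = d 1 (taylor_basis K n 2 [set p.1; p.2]).
  case: p => i j /=; have [ij|ij] := boolP (i != j); last by exists 0.
  pose m := lcm_gen g [set i; j].
  have Xm v : v \in [set i; j] -> v \in gen_divisors g m.
    by move=> vij; rewrite inE le_lcm_gen.
  have [|||r [rE _ dr]] := @path_syzygy E (gen_divisors g m) m j i (connE m).
  - by move=> v; rewrite inE.
  - by apply: Xm; rewrite set22.
  - by apply: Xm; rewrite set21.
  exists ((-1) ^+ (i < j)%N *: r) => _; split.
    by rewrite -[_ *: r]addr0; apply: supported_onP => //; apply: supported_on0.
  by rewrite linearZ_LR dr taylor_diff_edge.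
have /boolp.choice [tau tauE] : forall F : taylor_index k 2, exists r : T 2,
    supported_on E r /\ d 1 r = d 1 (ffun_delta S F).
  move=> F; rewrite -taylor_basis_delta; case: F => F /= F2.
  have /cards2P [i [j [ij FE]]] := F2.
  by have [r /(_ ij) [rE dr]] := lift (i, j); exists r; rewrite FE.
pose Tau := ffun_lift tau.
have TauE u : supported_on E (Tau u).
  move=> F FE; rewrite taylor_coef_sum big1 // => F' _.
  by rewrite taylor_coefZ (tauE F').1 ?mulr0.
have dTau u : d 1 (Tau u) = d 1 u.
  by apply: ffun_lift_comp => F; apply: (tauE F).2.
(* [Tau] rewrites any element over the edges in [E] without changing its differential. [Psi] fixes
   every relation, since [s] kills it, and sends basis elements of [E] to relations supported on
   [E], which have no constant terms. *)
pose Psi : {linear T 2 -> T 2} := idfun \- (Tau \o s).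
have PsiE u : Psi u = u - Tau (s u) by [].
have indep r : supported_on E r -> d 1 r = 0 -> r = 0.
  move=> rE dr; have [y yr] := taylor_exactS dr.
  have Psir : Psi r = r by rewrite PsiE -yr sd raddf0 subr0.
  (* Each application of [Psi] raises the order of vanishing, so the fixed element [r] vanishes to
     all orders. *)
  suff low D F m : (mdeg m < D)%N -> (taylor_coef r F)@_m = 0.
    apply: taylor_ext => F; rewrite taylor_coef0; apply/mpolyP => m.
    by rewrite mcoeff0; apply: (low (mdeg m).+1).
  elim: D F m => // D IHD F m mD; rewrite -{1}Psir taylor_coef_linear raddf_sum big1 //.
  move=> F' _; rewrite -(taylor_coef_val r F') -[LHS]/((_ * _)@_m).
  have [F'E|F'E] := boolP (val F' \in E); last by rewrite rE // mul0r mcoeff0.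
  apply: (mcoeffM_low (IHD _)) mD; apply: minimal.
    rewrite PsiE -taylor_basis_delta => F0 F0E; rewrite taylor_coefB TauE // subr0.
    rewrite taylor_basis_coef ?(eqP (valP F')) //.
    by case: eqP => // F0F; rewrite F0F F'E in F0E.
  by rewrite PsiE linearB dTau ds subrr.
split=> //; first exact: adjacent_sym.
- move=> C v u w connC vC uC wC /andP [vu vuE] /andP [vw vwE].
  apply/eqP; apply: contraT => uw.
  (* Two edges from [v] into [C], closed up by a syzygy inside [C], form a relation over [E] whose
     coefficient at the edge vu is nonzero. *)
  pose m := lcm_gen g setT.
  have [|rC [rE rC0 drC]] := @path_syzygy E C m u w connC _ uC wC.
    by move=> x _; rewrite le_lcm_gen ?inE.
  have [a a0 da] := edge_bridge vu (lcm_genS g (subsetT _)).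
  have [b _ db] := edge_bridge vw (lcm_genS g (subsetT _)).
  have basisE x : x \in C -> [set v; x] \in E -> v != x ->
      supported_on E (taylor_basis K n 2 [set v; x]).
    move=> xC xE vx F FE; rewrite taylor_basis_coef ?cards2 ?vx //.
    by case: eqP => // FF; rewrite FF xE in FE.
  pose r := a *: taylor_basis K n 2 [set v; u] +
    (- b *: taylor_basis K n 2 [set v; w] + rC).
  have r0 : r = 0.
    apply: indep; first apply: supported_onP; first exact: basisE.
      by apply: supported_onP => //; apply: basisE.
    rewrite /r linearD da linearD drC scaleNr linearN db.
    exact: triangle_sum.
  have := taylor_coef_lin3 a (- b) (taylor_basis K n 2 [set v; u])
    (taylor_basis K n 2 [set v; w]) rC [set v; u].
  rewrite -/r {}r0 taylor_coef0 (rC0 [set v; u]) ?addr0; last first.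
    by apply: contra vC => /subsetP; apply; rewrite set21.
  rewrite !taylor_basis_coef ?cards2 ?vu ?vw // eqxx mulr1.
  have -> : [set v; u] == [set v; w] = false.
    apply/negbTE/eqP => /setP /(_ u); rewrite !inE eqxx orbT (negbTE uw) orbF.
    by rewrite eq_sym (negbTE vu).
  by rewrite mulr0 addr0 => /esym a0'; rewrite a0' eqxx in a0.
- by rewrite -allm; apply: connE.
Qed.

End SyzygyTree.

(** * The cases of the projective dimension *)

Theorem corollary7p2 (K : fieldType) (n : nat) (I : idealr {mpoly K[n]})
    (G : seq 'X_{1..n}) (k p q : nat) :
  monomial_ideal I ->
  minimal_generators I G -> size G = k ->
  is_pdim {ideal_quot I} p -> is_pdim (ideal_mod I) q ->
  p%:Z \in [:: 1; 2; k%:Z - 2; k%:Z - 1; k%:Z] ->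
  (spdim (@quot_gr n K I) <= p)%N /\ (spdim (@ideal_gr n K I) <= q)%N.
Proof.
move=> _ [_ genI _] sizeG [resI minp] [resq _] pk.
have pq : (p.-1 <= q)%N by have := minp _ (quot_resolution resq); lia.
(* Since [p.-1] is at most [q], codimension [p.-1] suffices for the ideal. *)
suff [quot_p ideal_p] : stanley_codim_le p (ideal_compl (generator (G := G)) setT) /\
    stanley_codim_le p.-1 (in_ideal (generator (G := G)) setT).
  split; first exact: spdim_quot quot_p.
  by apply: spdim_ideal (stanley_codim_leW pq ideal_p).
have [h hE] := taylor_homotopy genI resI.
have cardG : #|[set: 'I_(size G)]| = k by rewrite cardsT card_ord.
have idealE A m : ideal_diff (generator (G := G)) A set0 m = in_ideal (generator (G := G)) A m.
  by rewrite /ideal_diff in_ideal0 andbT.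
have card_bound (A : {set 'I_(size G)}) :
    stanley_codim_le #|A| (ideal_compl (generator (G := G)) A) /\
    stanley_codim_le #|A|.-1 (in_ideal (generator (G := G)) A).
  split; first exact: ideal_compl_card.
  by apply: stanley_codim_le_ext (idealE A) (ideal_diff_card _ (sub0set A)).
(* The differences are taken in the integers, so they yield exact equations for [k]. *)
have {}pk : p = 1%N \/ p = 2%N \/ k = p.+2 \/ k = p.+1 \/ k = p.
  by move: pk; rewrite !inE => /or4P [/eqP|/eqP|/eqP|/orP [] /eqP]; lia.
case: pk => [p1|[p2|[kE|[kE|kE]]]].
- subst p; have [G0|/set0Pn [l _]] := eqVneq [set: 'I_(size G)] set0.
    have k0 : k = 0%N by rewrite -cardG G0 cards0.
    have [c1 c2] := card_bound setT; rewrite cardG k0 in c1 c2.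
    by split=> //; apply: stanley_codim_leW c1.
  have [i gi] := exactness_principal l hE.
  have iE m : in_ideal (generator (G := G)) [set i] m = in_ideal (generator (G := G)) setT m.
    apply/idP/idP; first by apply: in_idealS; apply: subsetT.
    case/in_idealP => j _ jm; apply/in_idealP; exists i; first by rewrite inE.
    exact: lepm_trans (gi j) jm.
  have [c1 c2] := card_bound [set i]; rewrite cards1 in c1 c2.
  split; last exact: stanley_codim_le_ext iE c2.
  by apply: stanley_codim_le_ext c1 => m; rewrite /ideal_compl iE.
- subst p; have [e [esym acyc connT conn]] := exactness_tree hE.
  split; first exact (ideal_compl_tree esym acyc connT conn).
  exact (in_ideal_tree esym acyc connT conn).
- have t : two_covered (generator (G := G)) setT.
    by apply: (exactness_two_covered hE); rewrite sizeG kE.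
  have := ideal_compl_two_covered t; have := in_ideal_two_covered t.
  by rewrite cardG kE.
- have o : one_covered (generator (G := G)) setT.
    by apply: (exactness_one_covered hE); rewrite sizeG kE.
  have := ideal_compl_covered o; have := in_ideal_covered o.
  by rewrite cardG kE.
- by have := card_bound setT; rewrite cardG kE.
Qed.
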